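(* There exists $k_0$ such that for every fixed integer $k\ge k_0$ the following holds. For each $n\ge 1$ let $U_1^{(n)},\dots,U_k^{(n)}$ be independent Haar-distributed random unitary $n\times n$ matrices, all defined (for all $n$) on a common probability space, and consider the random unitary channel $\Psi_{k,n}:B(\mathbb{C}^n)\to B(\mathbb{C}^n)$ and its conjugate $\overline{\Psi}_{k,n}:B(\mathbb{C}^n)\to B(\mathbb{C}^n)$, $$\Psi_{k,n}(X)=\frac1k\sum_{i=1}^kU_i^{(n)}X\,U_i^{(n)*},\qquad \overline{\Psi}_{k,n}(X)=\frac1k\sum_{i=1}^k\overline{U_i^{(n)}}\,X\,\big(U_i^{(n)}\big)^{t}.$$ Then, with probability one, for all $n$ large enough, additivity of the minimum output entropy is violated: $$H_{\min}\big(\Psi_{k,n}\otimes\overline{\Psi}_{k,n}\big)\ <\ H_{\min}(\Psi_{k,n})+H_{\min}(\overline{\Psi}_{k,n}).$$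
   Context: For a finite-dimensional Hilbert space $H$, $B(H)$ is the algebra of linear operators on $H$ and $D(H)\subset B(H)$ is the set of density matrices, i.e. positive semidefinite operators of trace $1$. For $X\in D(H)$ the von Neumann entropy is $H(X)=-\mathrm{Tr}(X\log X)$ (functional calculus, natural logarithm, $0\log 0=0$). A quantum channel $\Phi:B(H_1)\to B(H_2)$ is a completely positive trace preserving linear map; its minimum output entropy is $H_{\min}(\Phi)=\min_{X\in D(H_1)}H(\Phi(X))$. For a matrix $U$, $\overline U$ is its entrywise complex conjugate and $U^t$ its transpose. ''With probability one, for all $n$ large enough'' means that almost surely there is a (random) $n_0$ such that the inequality holds for all $n\ge n_0$. *)

(* Defs.v *)
From HB Require Import structures.
From mathcomp Require Import all_boot all_order all_algebra.
From mathcomp Require Import all_classical all_reals all_analysis.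
From mathcomp Require Export complex mxtens.

Set Implicit Arguments.
Unset Strict Implicit.
Unset Printing Implicit Defensive.

Import Order.TTheory GRing.Theory Num.Theory.
Import numFieldNormedType.Exports.

Local Open Scope classical_set_scope.
Local Open Scope ring_scope.
Local Open Scope sesquilinear_scope.

Section Entropy.
Context {R : realType}.
Local Notation C := R[i].

(* In the order of R[i], 0 <= z means that z is real and nonnegative. *)
Definition psdmx n (X : 'M[C]_n) : Prop :=
  X \is hermsymmx /\ forall v : 'cV[C]_n, 0 <= (v ^t* *m X *m v) 0 0.

Definition density n : set 'M[C]_n := [set X | psdmx X /\ \tr X = 1].

(* Functional calculus for Hermitian X, through the unitary diagonalization
   X = invmx (spectralmx X) *m diag_mx (spectral_diag X) *m spectralmx X,
   where spectral_diag X has real entries. *)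
Definition hermfun (f : R -> R) n (X : 'M[C]_n) : 'M[C]_n :=
  invmx (spectralmx X)
    *m diag_mx (map_mx (fun z : C => (f (complex.Re z))%:C%C) (spectral_diag X))
    *m spectralmx X.

(* The natural logarithm ln satisfies ln 0 = 0 here, hence 0 log 0 = 0. *)
Definition entropy n (X : 'M[C]_n) : R :=
  - complex.Re (\tr (X *m hermfun (@ln R) X)).

(* The infimum is a minimum when Phi is a channel and n > 0 (the entropy is
   continuous and the set of density matrices is compact). *)
Definition min_output_entropy n m (Phi : 'M[C]_n -> 'M[C]_m) : R :=
  inf [set entropy (Phi X) | X in @density n].

End Entropy.

Section Channels.
Context {R : realType}.
Local Notation C := R[i].

(* B(C^n (x) C^p) is 'M_(n * p), the basis vector e_i (x) e_j of C^n (x) C^p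
   having index mxtens_index (i, j), as in tensmx. *)
Definition tens_channel n m p q
    (Phi : 'M[C]_n -> 'M[C]_m) (Psi : 'M[C]_p -> 'M[C]_q)
    (X : 'M[C]_(n * p)) : 'M[C]_(m * q) :=
  \sum_(i < n) \sum_(j < n) \sum_(k < p) \sum_(l < p)
    X (mxtens_index (i, k)) (mxtens_index (j, l))
      *: tensmx (Phi (delta_mx i j)) (Psi (delta_mx k l)).

Definition random_unitary_channel k n (U : 'I_k -> 'M[C]_n) (X : 'M[C]_n) :
    'M[C]_n :=
  k%:R^-1 *: \sum_(i < k) U i *m X *m (U i) ^t*.

Definition conj_random_unitary_channel k n (U : 'I_k -> 'M[C]_n)
    (X : 'M[C]_n) : 'M[C]_n :=
  k%:R^-1 *: \sum_(i < k) map_mx Num.conj (U i) *m X *m (U i)^T.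

Lemma random_unitary_channel_linear k n (U : 'I_k -> 'M[C]_n) :
  linear (random_unitary_channel U).
Proof.
move=> a X Y; rewrite /random_unitary_channel scalerA mulrC -scalerA -scalerDr.
congr (_ *: _); rewrite scaler_sumr -big_split; apply: eq_bigr => i _ /=.
by rewrite mulmxDr mulmxDl -scalemxAr -scalemxAl.
Qed.

HB.instance Definition _ k n (U : 'I_k -> 'M[C]_n) :=
  GRing.isLinear.Build _ _ _ _ (random_unitary_channel U)
    (random_unitary_channel_linear U).

Lemma conj_random_unitary_channel_linear k n (U : 'I_k -> 'M[C]_n) :
  linear (conj_random_unitary_channel U).
Proof.
move=> a X Y.
rewrite /conj_random_unitary_channel scalerA mulrC -scalerA -scalerDr.
congr (_ *: _); rewrite scaler_sumr -big_split; apply: eq_bigr => i _ /=.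
by rewrite mulmxDr mulmxDl -scalemxAr -scalemxAl.
Qed.

HB.instance Definition _ k n (U : 'I_k -> 'M[C]_n) :=
  GRing.isLinear.Build _ _ _ _ (conj_random_unitary_channel U)
    (conj_random_unitary_channel_linear U).

Lemma tens_channel_linear n m p q
    (Phi : 'M[C]_n -> 'M[C]_m) (Psi : 'M[C]_p -> 'M[C]_q) :
  linear (tens_channel Phi Psi).
Proof.
move=> a X Y; rewrite /tens_channel scaler_sumr -big_split.
apply: eq_bigr => i _; rewrite scaler_sumr -big_split.
apply: eq_bigr => j _; rewrite scaler_sumr -big_split.
apply: eq_bigr => k _; rewrite scaler_sumr -big_split.
by apply: eq_bigr => l _; rewrite !mxE scalerDl scalerA.
Qed.

HB.instance Definition _ n m p q
    (Phi : 'M[C]_n -> 'M[C]_m) (Psi : 'M[C]_p -> 'M[C]_q) :=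
  GRing.isLinear.Build _ _ _ _ (tens_channel Phi Psi)
    (tens_channel_linear Phi Psi).

Lemma tens_channel_tensmx n m p q
    (Phi : {linear 'M[C]_n -> 'M[C]_m}) (Psi : {linear 'M[C]_p -> 'M[C]_q})
    (A : 'M[C]_n) (B : 'M[C]_p) :
  tens_channel Phi Psi (tensmx A B) = tensmx (Phi A) (Psi B).
Proof.
apply/matrixP => x y; rewrite {2}(matrix_sum_delta A) {2}(matrix_sum_delta B).
rewrite !linear_sum !mxE !summxE mulr_suml; apply: eq_bigr => i _.
rewrite !linear_sum !summxE mulr_suml; apply: eq_bigr => j _.
rewrite !summxE mulr_sumr; apply: eq_bigr => k _.
rewrite linear_sum !summxE mulr_sumr; apply: eq_bigr => l _.
by rewrite !linearZ /= !mxE !mxtens_indexK /= mulrACA.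
Qed.

End Channels.

Section RandomUnitaries.
Context {R : realType}.
Local Notation C := R[i].

(* The library's topology on a numFieldType such as R[i] is carried by its
   alias R[i]^o. *)
Definition borel_mx n : set (set 'M[C]_n) :=
  <<s [set A : set 'M[C]_n | open (A : set 'M[C^o]_n)] >>.

Context {d : measure_display} {T : measurableType d} (P : probability T R).

Record haar_unitary n (U : T -> 'M[C]_n) : Prop := HaarUnitary {
  haar_unitarymx : forall w, U w \is unitarymx ;
  haar_measurable : forall A, @borel_mx n A -> measurable (U @^-1` A) ;
  haar_left : forall V A, V \is unitarymx -> @borel_mx n A ->
    P [set w | A (V *m U w)] = P [set w | A (U w)] ;
  haar_right : forall V A, V \is unitarymx -> @borel_mx n A ->
    P [set w | A (U w *m V)] = P [set w | A (U w)] }.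

Definition mutually_independent k n (U : 'I_k -> T -> 'M[C]_n) : Prop :=
  forall (J : {set 'I_k}) (A : 'I_k -> set 'M[C]_n),
    (forall i, @borel_mx n (A i)) ->
    P [set w | forall i, i \in J -> A i (U i w)] =
      (\prod_(i in J) P (U i @^-1` A i))%E.

End RandomUnitaries.

(* Main.v *)
Require Import Defs.
From HB Require Import structures.
From mathcomp Require Import all_boot all_order all_algebra.
From mathcomp Require Import all_classical all_reals all_analysis.
From mathcomp Require Import measurable_realfun ring lra.

(** Additivity fails because the two channels, fed with the maximally entangled
    vector [bell], conspire: each of the [k] products of [U i] with its own
    conjugate fixes [bell], so the output has an eigenvalue of at least [1 / k],
    while its rank is at most [k ^ 2].  Its entropy is therefore at most
    [2 ln k - ln k / k + 1 / k] ([min_output_entropy_bell]).  It remains to show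
    that a single channel loses much less, namely that its minimum output
    entropy is at least [ln k - S / k] for a constant [S] that depends on
    neither [k] nor [n]; this suffices as soon as [ln k > 1 + 2 S]
    ([additivity_violated]).

    Entropy is bounded below by minus the logarithm of the purity, and purity is
    convex, so only pure inputs [x] matter.  There the purity is
    [(k + E) / k ^ 2], where [E] is the sum of [|<U p x, U q x>| ^ 2] over
    [p != q].  Hence everything reduces to a bound [E <= S] which holds, almost
    surely and for all large [n], for all unit vectors [x] at once
    ([haar_gram_bound]).

    Such a bound follows from strong asymptotic freeness and Haagerup's
    inequality; up to the value of the constant it also has the following
    elementary proof.  Fix [x], and coefficients [c] with zero diagonal and
    Hilbert-Schmidt norm at most [1 / 32].  Then the exponential moment of
    [n * Re (sum of c p q <U p x, U q x>)] is at most [exp n], uniformly in [k]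
    ([gram_mgf]).  Indeed the unitaries can be integrated out one at a time.
    Given the others, the exponent depends on [U j] through
    [n * Re <U j x, v>]; by invariance [v] may be replaced by any vector of the
    same length, and averaging over the vectors with entries of constant
    modulus and random signs gives at most [exp (2 n |v| ^ 2)] ([haar_mgf]).
    The new exponent is again a quadratic expression in the remaining vectors,
    and the Hilbert-Schmidt norm of its coefficients has dropped by enough to
    pay for the constants that appear ([hs_eliminated]).

    Markov's inequality turns the moment into a tail of the form
    [exp (- n (s - 1))].  The unit ball of C^n has a net of size [2 ^ (36 n)]
    ([complex_ball_net]) and the ball of coefficients one of a size depending on
    [k] only, so for a suitable absolute [s] a union bound leaves probabilities
    of order [2 ^- n], to which the Borel-Cantelli lemma applies.  Values on a
    net control a quadratic form on the whole ball ([gram_form_net]), and a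
    finite family of linear functionals controls the Hilbert-Schmidt norm of
    the Gram matrix ([hs_gram_offdiag_le]). *)

Set Implicit Arguments.
Unset Strict Implicit.
Unset Printing Implicit Defensive.
Import Order.TTheory GRing.Theory Num.Theory.
Import numFieldNormedType.Exports.
Local Open Scope classical_set_scope.
Local Open Scope ring_scope.
Local Open Scope sesquilinear_scope.

(** * The real inner product of C^n *)

Section RealInnerProduct.
Context {R : realType}.
Local Notation C := R[i].

(** Real part of the Hermitian inner product. Everything analytic only needs
    this real bilinear form; multiplying one argument by a complex scalar gives
    access to the imaginary parts. *)
Definition rip n (u v : 'cV[C]_n) : R := complex.Re ((u ^t* *m v) 0 0).

Lemma complexReD (a b : C) : complex.Re (a + b) = complex.Re a + complex.Re b.
Proof. by case: a b => [? ?] [? ?]. Qed.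

Lemma complexImD (a b : C) : complex.Im (a + b) = complex.Im a + complex.Im b.
Proof. by case: a b => [? ?] [? ?]. Qed.

Lemma complexReM (a b : C) : complex.Re (a * b) =
  complex.Re a * complex.Re b - complex.Im a * complex.Im b.
Proof. by case: a b => [? ?] [? ?]. Qed.

Lemma complexImM (a b : C) : complex.Im (a * b) =
  complex.Re a * complex.Im b + complex.Im a * complex.Re b.
Proof. by case: a b => [? ?] [? ?]. Qed.

Lemma complexRe_conj (a : C) : complex.Re (Num.conj a) = complex.Re a.
Proof. by case: a. Qed.

Lemma complexIm_conj (a : C) : complex.Im (Num.conj a) = - complex.Im a.
Proof. by case: a. Qed.

Lemma complexRe_sum (I : Type) (r : seq I) (p : pred I) (F : I -> C) :
  complex.Re (\sum_(i <- r | p i) F i) = \sum_(i <- r | p i) complex.Re (F i).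
Proof. exact: (big_morph (@complex.Re R) complexReD). Qed.

Lemma complexIm_sum (I : Type) (r : seq I) (p : pred I) (F : I -> C) :
  complex.Im (\sum_(i <- r | p i) F i) = \sum_(i <- r | p i) complex.Im (F i).
Proof. exact: (big_morph (@complex.Im R) complexImD). Qed.

Lemma ripE n (u v : 'cV[C]_n) :
  rip u v = \sum_i (complex.Re (u i 0) * complex.Re (v i 0)
                    + complex.Im (u i 0) * complex.Im (v i 0)).
Proof.
rewrite /rip !mxE complexRe_sum; apply: eq_bigr => i _.
by rewrite !mxE complexReM complexRe_conj complexIm_conj mulNr opprK.
Qed.

Lemma ripC n (u v : 'cV[C]_n) : rip u v = rip v u.
Proof. by rewrite !ripE; apply: eq_bigr => i _; ring. Qed.

Lemma ripDl n (u v w : 'cV[C]_n) : rip (u + v) w = rip u w + rip v w.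
Proof.
rewrite !ripE -big_split; apply: eq_bigr => i _ /=.
by rewrite !mxE complexReD complexImD; ring.
Qed.

Lemma ripDr n (u v w : 'cV[C]_n) : rip u (v + w) = rip u v + rip u w.
Proof. by rewrite ![rip u _]ripC ripDl. Qed.

Lemma rip_conjZ n (a : C) (u v : 'cV[C]_n) :
  rip (a *: u) v = rip u (Num.conj a *: v).
Proof.
rewrite !ripE; apply: eq_bigr => i _.
by rewrite !mxE !complexReM !complexImM complexRe_conj complexIm_conj; ring.
Qed.

Lemma ripZl n (a : R) (u v : 'cV[C]_n) : rip (a%:C%C *: u) v = a * rip u v.
Proof.
rewrite !ripE mulr_sumr; apply: eq_bigr => i _.
by rewrite !mxE !complexReM !complexImM /=; ring.
Qed.

Lemma ripZr n (a : R) (u v : 'cV[C]_n) : rip u (a%:C%C *: v) = a * rip u v.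
Proof. by rewrite ripC ripZl ripC. Qed.

Lemma rip0l n (v : 'cV[C]_n) : rip 0 v = 0.
Proof. by rewrite ripE big1// => i _; rewrite !mxE /= !mul0r addr0. Qed.

Lemma rip0r n (v : 'cV[C]_n) : rip v 0 = 0.
Proof. by rewrite ripC rip0l. Qed.

Lemma ripNl n (u v : 'cV[C]_n) : rip (- u) v = - rip u v.
Proof.
rewrite !ripE -sumrN; apply: eq_bigr => i _; rewrite !mxE.
by case: (u i 0) => [? ?] /=; ring.
Qed.

Lemma ripNr n (u v : 'cV[C]_n) : rip u (- v) = - rip u v.
Proof. by rewrite ripC ripNl ripC. Qed.

Lemma rip_suml n (I : Type) (r : seq I) (p : pred I) (F : I -> 'cV[C]_n) v :
  rip (\sum_(i <- r | p i) F i) v = \sum_(i <- r | p i) rip (F i) v.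
Proof. exact: (big_morph (fun u => rip u v) (fun x y => ripDl x y v) (rip0l
  v)). Qed.

Lemma rip_sumr n (I : Type) (r : seq I) (p : pred I) (F : I -> 'cV[C]_n) v :
  rip v (\sum_(i <- r | p i) F i) = \sum_(i <- r | p i) rip v (F i).
Proof. by rewrite ripC rip_suml; apply: eq_bigr => i _; rewrite ripC. Qed.

Lemma rip_ge0 n (u : 'cV[C]_n) : 0 <= rip u u.
Proof.
by rewrite ripE; apply: sumr_ge0 => i _; rewrite -!expr2 addr_ge0 ?sqr_ge0.
Qed.

Lemma rip_eq0 n (u : 'cV[C]_n) : rip u u = 0 -> u = 0.
Proof.
rewrite ripE => /eqP; rewrite psumr_eq0; last first.
  by move=> i _; rewrite -!expr2 addr_ge0 ?sqr_ge0.
move=> /allP u0; apply/matrixP => i j; rewrite (ord1 j) mxE.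
have /eqP := u0 i (mem_index_enum i).
rewrite /= -!expr2 => /eqP; rewrite paddr_eq0 ?sqr_ge0// !sqrf_eq0.
by case: (u i 0) => a b /= /andP[/eqP -> /eqP ->].
Qed.

Lemma rip_adj n m (W : 'M[C]_(m, n)) u v : rip (W *m u) v = rip u (W ^t* *m v).
Proof. by rewrite /rip trmx_mul map_mxM mulmxA. Qed.

Lemma unitarymxV n (W : 'M[C]_n) : W \is unitarymx -> W ^t* *m W = 1%:M.
Proof. by move=> uW; rewrite -invmx_unitary// mulVmx// unitarymx_unit. Qed.

Lemma rip_unitary n (W : 'M[C]_n) u v :
  W \is unitarymx -> rip (W *m u) (W *m v) = rip u v.
Proof. by move=> uW; rewrite rip_adj mulmxA unitarymxV// mul1mx. Qed.

(** The reflection along [z = v - w] normalised by [z^* v] instead of by half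
    the squared length of [z]: the two agree in their real parts because [v]
    and [w] have the same length, which is exactly what unitarity needs. *)
Lemma unitary_transitive n (v w : 'cV[C]_n) : rip v v = rip w w ->
  exists2 W : 'M[C]_n, W \is unitarymx & W *m v = w.
Proof.
move=> vw; have [->|neq_vw] := eqVneq v w.
  by exists 1%:M; rewrite ?mul1mx// qualifE /= trmx1 map_mx1 mulmx1.
pose z := v - w; pose al := (z ^t* *m v) 0 0; pose N := (z ^t* *m z) 0 0.
have zv : z ^t* *m v = al%:M by rewrite [LHS]mx11_scalar.
have zz : z ^t* *m z = N%:M by rewrite [LHS]mx11_scalar.
have NJ : Num.conj N = N.
  have : (N%:M : 'M[C]_1) ^t* = N%:M.
    by rewrite -zz trmx_mul map_mxM trmxCK.
  by move/matrixP/(_ 0 0); rewrite !mxE eqxx !mulr1n.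
have Re_al : complex.Re N = complex.Re al *+ 2.
  rewrite -/(rip z z) -/(rip z v) /z !(ripDl, ripDr, ripNl, ripNr) vw (ripC w
    v).
  by move: (rip v w) (rip w w) => a b; ring.
have alN : al + Num.conj al = N.
  case: (al) (N) Re_al NJ => [a b] [x y] /= -> [] /eqP.
  rewrite eq_sym -subr_eq0 opprK -mulr2n mulrn_eq0 /= => /eqP ->.
  by apply/eqP; rewrite eq_complex /= -mulr2n subrr !eqxx.
have al0 : al != 0.
  apply: contraNneq neq_vw => al0; rewrite -subr_eq0; apply/eqP/rip_eq0.
  by rewrite /rip -/z -/N Re_al al0 /= mul0rn.
have alJ0 : Num.conj al != 0 by rewrite conjC_eq0.
pose W := 1%:M - al^-1 *: (z *m z ^t*).
exists W; last first.
  rewrite /W mulmxBl mul1mx -scalemxAl -mulmxA zv mul_mx_scalar scalerA mulVf//.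
  by rewrite scale1r /z opprB addrC subrK.
apply/unitarymxP; rewrite /W.
have -> : (1%:M - al^-1 *: (z *m z ^t*)) ^t* =
          1%:M - (Num.conj al)^-1 *: (z *m z ^t*).
  rewrite linearB /= linearZ /= map_mxB map_mxZ trmx1 map_mx1 trmx_mul.
  by rewrite map_mxM trmxCK /= fmorphV.
rewrite mulmxBl mul1mx mulmxBr mulmx1 -scalemxAl -scalemxAr mulmxA.
rewrite -(mulmxA z) zz mul_mx_scalar -scalemxAl !scalerA.
rewrite -addrA -opprD -scalerBl -scalerDl -alN.
set s := (_ + _ : C); suff -> : s = 0 by rewrite scale0r subr0.
by rewrite /s; field; rewrite al0 alJ0.
Qed.

End RealInnerProduct.

(** * A bound on cosh and the measurability of matrix entries *)

(** The optimal constant in the exponent is [1 / 2].  With [2], the inequality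
    follows from [1 + t <= exp t] alone: for [|t| >= 1] it is termwise, and for
    [|t| < 1] one uses [exp (t / 2) <= 1 / (1 - t / 2)]. *)
Lemma expR_avg_le {R : realType} (t : R) :
  expR t + expR (- t) <= 2 * expR (2 * t ^+ 2).
Proof.
have [t1|t1] := leP 1 `|t|.
  have t2 : `|t| <= 2 * t ^+ 2.
    by rewrite -real_normK ?num_real//; nra.
  have [] : t <= 2 * t ^+ 2 /\ - t <= 2 * t ^+ 2.
    by split; apply: le_trans t2; rewrite ?ler_norm// -normrN ler_norm.
  rewrite -(ler_expR t) -(ler_expR (- t)); lra.
have t4 : t ^+ 2 < 1 by rewrite -real_normK ?num_real// expr_lt1.
have := expR_ge1Dx (2 * t ^+ 2).
have -> : t = t / 2 + t / 2 by rewrite -splitr.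
rewrite opprD !expRD -!splitr.
have := expR_ge1Dx (t / 2); have := expR_ge1Dx (- (t / 2)).
have : expR (t / 2) * expR (- (t / 2)) = 1 by rewrite expRN divff// expR_eq0.
move: (expR (t / 2)) (expR (- (t / 2))) (expR_gt0 (t / 2)) (expR_gt0 (- (t /
  2))).
set b := t / 2; have b4 : b ^+ 2 < 1 / 4 by rewrite /b; nra.
have -> : 2 * t ^+ 2 = 8 * b ^+ 2 by rewrite /b; field.
move=> x y x0 y0 xy yb xb E8.
have b1 : -1/2 < b < 1/2 by apply/andP; split; nra.
have xl : x * (1 - b) <= 1 by rewrite -xy ler_pM2l//; lra.
have yl : y * (1 + b) <= 1 by rewrite -xy mulrC ler_pM2r//; lra.
have xl2 : x * x * (1 - b) ^+ 2 <= 1.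
  by rewrite -expr2 -exprMn expr_le1//; rewrite mulr_ge0//; lra.
have yl2 : y * y * (1 + b) ^+ 2 <= 1.
  by rewrite -expr2 -exprMn expr_le1//; rewrite mulr_ge0//; lra.
have d0 : 0 < (1 - b ^+ 2) ^+ 2 by rewrite exprn_gt0//; lra.
have H1 : x * x * (1 - b ^+ 2) ^+ 2 <= (1 + b) ^+ 2.
  have -> : x * x * (1 - b ^+ 2) ^+ 2 = (x * x * (1 - b) ^+ 2) * (1 + b) ^+ 2.
    by ring.
  by rewrite ler_piMl// sqr_ge0.
have H2 : y * y * (1 - b ^+ 2) ^+ 2 <= (1 - b) ^+ 2.
  have -> : y * y * (1 - b ^+ 2) ^+ 2 = (y * y * (1 + b) ^+ 2) * (1 - b) ^+ 2.
    by ring.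
  by rewrite ler_piMl// sqr_ge0.
apply: le_trans (_ : 2 * (1 + 8 * b ^+ 2) <= _); last lra.
rewrite -(ler_pM2r d0) mulrDl.
apply: le_trans (lerD H1 H2) _.
have -> : (1 + b) ^+ 2 + (1 - b) ^+ 2 = 2 + 2 * b ^+ 2 by ring.
have := sqr_ge0 b; move: (b ^+ 2) b4 => s b4 s0.
have s5 : 0 <= 5 - 15 * s + 8 * s ^+ 2 by have := sqr_ge0 s; lra.
have := mulr_ge0 s0 s5; lra.
Qed.

Section Coordinates.
Context {R : realType}.
Local Notation C := R[i].

(** The alias [C^o] carries both the topology and the distinguished point that
    generating a measurable type requires. *)
Definition mx_opens n : set (set 'M[C^o]_n) := [set A | open A].

Lemma measurable_fun_real_mx n (f : C -> R) i j :
  (forall z z' : C, `|f z - f z'|%:C%C <= `|z - z'|) ->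
  measurable_fun setT
    (fun M : g_sigma_algebraType (@mx_opens n) => f ((M : 'M[C]_n) i j)).
Proof.
move=> f1; apply: (measurability _ (RGenOInfty.measurableE R)).
move=> _ [_ [a ->] <-]; rewrite setTI.
apply: sub_sigma_algebra; rewrite /mx_opens /=.
rewrite openE => M /=; rewrite in_itv /= andbT => aM.
apply/nbhs_ballP; exists (f (M i j) - a)%:C%C => /=.
  by rewrite ltcR subr_gt0.
move=> N [_ /(_ i j)] /=; rewrite in_itv /= andbT => MN.
have : `|f (M i j) - f (N i j)| < f (M i j) - a.
  by rewrite -ltcR; apply: le_lt_trans MN; exact: f1.
by have := ler_norm (f (M i j) - f (N i j)); lra.
Qed.

Lemma measurable_Re_mx n i j : measurable_fun setT
  (fun M : g_sigma_algebraType (@mx_opens n) => complex.Re ((M : 'M[C]_n) i j)).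
Proof.
apply: measurable_fun_real_mx => z z'.
suff -> : complex.Re z - complex.Re z' = complex.Re (z - z').
  exact: normc_ge_Re.
by case: z z' => [? ?] [? ?].
Qed.

Lemma measurable_Im_mx n i j : measurable_fun setT
  (fun M : g_sigma_algebraType (@mx_opens n) => complex.Im ((M : 'M[C]_n) i j)).
Proof.
apply: measurable_fun_real_mx => z z'.
have -> : complex.Im z - complex.Im z' = - complex.Re ((z - z') * 'i%C).
  by case: z z' => [? ?] [? ?] /=; ring.
rewrite normrN; apply: le_trans (normc_ge_Re _) _.
by rewrite normrM (_ : `|'i%C| = 1) ?mulr1// complexiE normCi.
Qed.

End Coordinates.

(** * Measurable random vectors and invariance *)

Section MeasurableVectors.
Context {R : realType}.
Local Notation C := R[i].

Definition measurable_vec d (T : measurableType d) n (u : T -> 'cV[C]_n) :=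
  forall i, measurable_fun setT (fun w => complex.Re (u w i 0)) /\
            measurable_fun setT (fun w => complex.Im (u w i 0)).

Lemma measurable_vec_comp d (T : measurableType d) d' (T' : measurableType d')
    n (u : T' -> 'cV[C]_n) (f : T -> T') :
  measurable_fun setT f -> measurable_vec u -> measurable_vec (u \o f).
Proof.
move=> mf mu i; have [mre mim] := mu i.
by split; [exact: (measurableT_comp mre)|exact: (measurableT_comp mim)].
Qed.

Lemma measurable_vecZ d (T : measurableType d) n (u : T -> 'cV[C]_n) (a : C) :
  measurable_vec u -> measurable_vec (fun w => a *: u w).
Proof.
move=> mu i; have [mre mim] := mu i; split.
  under eq_fun do rewrite mxE complexReM.
  by apply: measurable_funB; apply: measurable_funM => //; exact:
    measurable_cst.
under eq_fun do rewrite mxE complexImM.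
by apply: measurable_funD; apply: measurable_funM => //; exact: measurable_cst.
Qed.

Lemma measurable_vec_sum d (T : measurableType d) n (I : Type) (r : seq I)
    (p : pred I) (u : I -> T -> 'cV[C]_n) :
  (forall i, measurable_vec (u i)) ->
  measurable_vec (fun w => \sum_(i <- r | p i) u i w).
Proof.
move=> mu i; split.
  under eq_fun do rewrite summxE complexRe_sum -big_filter.
  by apply: measurable_sum => j; have [] := mu j i.
under eq_fun do rewrite summxE complexIm_sum -big_filter.
by apply: measurable_sum => j; have [] := mu j i.
Qed.

Lemma measurable_rip d (T : measurableType d) n (u v : T -> 'cV[C]_n) :
  measurable_vec u -> measurable_vec v ->
  measurable_fun setT (fun w => rip (u w) (v w)).
Proof.
move=> mu mv; under eq_fun do rewrite ripE.
apply: measurable_sum => i; have [? ?] := mu i; have [? ?] := mv i.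
by apply: measurable_funD; exact: measurable_funM.
Qed.

Lemma measurable_vec_cst d (T : measurableType d) n (v : 'cV[C]_n) :
  measurable_vec (fun _ : T => v).
Proof. by move=> i; split; exact: measurable_cst. Qed.

Lemma measurable_vec_mulmx n (x : 'cV[C]_n) :
  measurable_vec
    (fun M : g_sigma_algebraType (@mx_opens R n) => (M : 'M[C]_n) *m x).
Proof.
move=> i; split.
  under eq_fun do rewrite mxE complexRe_sum.
  apply: measurable_sum => j; under eq_fun do rewrite complexReM.
  apply: measurable_funB; apply: measurable_funM; try exact: measurable_cst.
    exact: measurable_Re_mx.
  exact: measurable_Im_mx.
under eq_fun do rewrite mxE complexIm_sum.
apply: measurable_sum => j; under eq_fun do rewrite complexImM.
apply: measurable_funD; apply: measurable_funM; try exact: measurable_cst.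
  exact: measurable_Re_mx.
exact: measurable_Im_mx.
Qed.

End MeasurableVectors.

Section HaarColumn.
Context {R : realType} {d : measure_display} {T : measurableType d}.
Context (P : probability T R).
Local Notation C := R[i].

Lemma haar_measurable_fun n (U : T -> 'M[C]_n) : haar_unitary P U ->
  measurable_fun setT (U : T -> g_sigma_algebraType (@mx_opens R n)).
Proof. by move=> hU _ A mA; rewrite setTI; exact: (haar_measurable hU). Qed.

Lemma haar_measurable_vec n (U : T -> 'M[C]_n) (x : 'cV[C]_n) :
  haar_unitary P U -> measurable_vec (fun w => U w *m x).
Proof.
move=> hU; exact: (measurable_vec_comp (haar_measurable_fun hU)
  (measurable_vec_mulmx x)).
Qed.

(** Invariance of the law of the matrix is only used through real random
    variables: the preimage of a Borel set of reals under
    [M |-> rip (M x) v] is a Borel set of matrices, to which left invariance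
    applies. *)
Lemma haar_rip_unitary n (U : T -> 'M[C]_n) (x v : 'cV[C]_n) (W : 'M[C]_n)
    (g : R -> \bar R) : haar_unitary P U -> W \is unitarymx ->
  measurable_fun setT g -> (forall r, 0 <= g r)%E ->
  (\int[P]_w g (rip (U w *m x) (W *m v)) = \int[P]_w g (rip (U w *m x) v))%E.
Proof.
move=> hU uW mg g0.
have mX (y : 'cV[C]_n) : measurable_fun setT (fun w => rip (U w *m x) y).
  apply: measurable_rip; first exact: haar_measurable_vec.
  exact: measurable_vec_cst.
have pf (y : 'cV[C]_n) : (\int[P]_w g (rip (U w *m x) y) =
    \int[pushforward P (fun w => rip (U w *m x) y)]_r g r)%E.
  by rewrite (ge0_integral_pushforward (mX y)).
rewrite !pf; apply: eq_measure_integral => /= B mB _.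
rewrite /pushforward.
have uW' : W ^t* \is unitarymx by rewrite trmxC_unitary.
have mB' : borel_mx (fun M : 'M[C]_n => B (rip (M *m x) v)).
  have := measurable_rip (measurable_vec_mulmx x)
            (measurable_vec_cst (g_sigma_algebraType (@mx_opens R n)) v).
  by move=> /(_ measurableT B mB); rewrite setTI.
have := haar_left hU uW' mB'; congr (_ = _); congr (P _).
by apply/funext => w /=; rewrite -mulmxA rip_adj trmxCK.
Qed.

End HaarColumn.

(** * The exponential moment of one Haar vector *)

Section HaarMgf.
Context {R : realType} {d : measure_display} {T : measurableType d}.
Context (P : probability T R).
Local Notation C := R[i].

Lemma haar_norm n (U : T -> 'M[C]_n) (x : 'cV[C]_n) w : haar_unitary P U ->
  rip (U w *m x) (U w *m x) = rip x x.
Proof. by move=> hU; rewrite rip_unitary//; exact: haar_unitarymx hU w. Qed.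

(** By invariance [v] may be replaced by each of the [2 ^ n] vectors [s e] of
    the same length whose entries are [r] or [- r].  Averaging over these signs
    turns the exponential into a product of hyperbolic cosines, which
    [expR_avg_le] bounds by a Gaussian factor whose exponent adds up to at
    most [2 n |v| ^ 2]. *)
Lemma haar_mgf n (U : T -> 'M[C]_n) (x v : 'cV[C]_n) :
  (0 < n)%N -> haar_unitary P U -> rip x x <= 1 ->
  (\int[P]_w (expR (n%:R * rip (U w *m x) v))%:E
     <= (expR (2 * n%:R * rip v v))%:E)%E.
Proof.
move=> n0 hU x1.
have nR0 : 0 < n%:R :> R by rewrite ltr0n.
pose r := Num.sqrt (rip v v / n%:R).
have r2 : n%:R * r ^+ 2 = rip v v.
  by rewrite sqr_sqrtr ?divr_ge0 ?rip_ge0// mulrC divfK// gt_eqF.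
pose s (e : {ffun 'I_n -> bool}) : 'cV[C]_n :=
  \col_i (r * (-1) ^+ e i)%:C%C.
have ripv (y : 'cV[C]_n) e :
    rip y (s e) = \sum_i complex.Re (y i 0) * (r * (-1) ^+ e i).
  by rewrite ripE; apply: eq_bigr => i _; rewrite mxE /= mulr0 addr0.
have ss e : rip v v = rip (s e) (s e).
  rewrite ripv -r2 -[n in LHS]card_ord -sum1_card natr_sum mulr_suml.
  by apply: eq_bigr => i _; rewrite mxE /= mul1r -expr2 exprMn sqrr_sign mulr1.
pose g (t : R) : \bar R := (expR (n%:R * t))%:E.
have mg : measurable_fun setT g.
  apply/measurable_EFinP; apply: measurableT_comp; first exact: measurable_expR.
  by apply: measurable_funM; [exact: measurable_cst|exact: measurable_id].
have g0 t : (0 <= g t)%E by rewrite lee_fin expR_ge0.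
have mgs y : measurable_fun setT (fun w => g (rip (U w *m x) y)).
  apply: measurableT_comp => //; apply: measurable_rip.
    exact: (haar_measurable_vec _ hU).
  exact: measurable_vec_cst.
have same e : (\int[P]_w g (rip (U w *m x) (s e))
             = \int[P]_w g (rip (U w *m x) v))%E.
  have [W uW <-] := unitary_transitive (ss e).
  exact: haar_rip_unitary.
have pointwise w : \sum_e expR (n%:R * rip (U w *m x) (s e)) <=
    2 ^+ n * expR (2 * n%:R * rip v v).
  pose y := U w *m x.
  pose F (i : 'I_n) (b : bool) :=
    expR (n%:R * (complex.Re (y i 0) * (r * (-1) ^+ b))).
  have -> : \sum_e expR (n%:R * rip (U w *m x) (s e)) =
            \prod_i \sum_b F i b.
    rewrite bigA_distr_bigA; apply: eq_bigr => e _.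
    by rewrite ripv mulr_sumr expR_sum.
  apply: le_trans (_ : \prod_(i < n)
    (2 * expR (2 * n%:R ^+ 2 * r ^+ 2 * complex.Re (y i 0) ^+ 2)) <= _).
    apply: ler_prod => i _; apply/andP; split.
      by apply: sumr_ge0 => b _; exact: expR_ge0.
    rewrite big_bool /F /= expr0 expr1 addrC.
    have := expR_avg_le (n%:R * (complex.Re (y i 0) * r)).
    rewrite !mulr1 !mulrN1 !mulrN !exprMn => /le_trans; apply.
    by rewrite ler_pM2l// ler_expR le_eqVlt; apply/orP; left; apply/eqP; ring.
  rewrite big_split /= prodr_const card_ord ler_pM2l ?exprn_gt0//.
  rewrite -expR_sum ler_expR -mulr_sumr.
  have -> : 2 * n%:R ^+ 2 * r ^+ 2 = 2 * n%:R * rip v v by rewrite -r2; ring.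
  rewrite ler_piMr//; first by rewrite !mulr_ge0 ?rip_ge0// ler0n.
  apply: le_trans x1; rewrite -(haar_norm x w hU) -/y ripE.
  by apply: ler_sum => i _; rewrite -!expr2 lerDl sqr_ge0.
have sumI : ((2 ^+ n)%:E * \int[P]_w g (rip (U w *m x) v) =
    \int[P]_w (\sum_e expR (n%:R * rip (U w *m x) (s e)))%:E)%E.
  under [RHS]eq_integral do rewrite -sumEFin.
  rewrite ge0_integral_sum//; last by move=> e; exact: mgs.
  under eq_bigr do rewrite same.
  by rewrite sumr_const card_ffun card_bool card_ord -[RHS]mule_natl natrX.
have pos2 : 0 < 2 ^+ n :> R by rewrite exprn_gt0.
rewrite -(@lee_pmul2l _ (2 ^+ n)%:E)// ?lte_fin// sumI.
apply: (@le_trans _ _ (\int[P]_w (2 ^+ n * expR (2 * n%:R * rip v v))%:E)%E).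
  apply: ge0_le_integral => //.
  - by move=> w _; rewrite lee_fin sumr_ge0// => e _; exact: expR_ge0.
  - apply/measurable_EFinP; apply: measurable_sum => e.
    exact/measurable_EFinP/mgs.
  - by move=> w _; rewrite lee_fin.
rewrite integral_cst//.
by rewrite [X in (_ * X)%E](@probability_setT _ _ _ P) mule1 EFinM.
Qed.

End HaarMgf.

(** * Independence and integrating out one unitary *)

Section Independence.
Context {R : realType} {d : measure_display} {T : measurableType d}.
Context (P : probability T R).
Local Notation C := R[i].

(** Independence says that the joint law of [X] and [Y] is the product of their
    laws, because both measures agree on rectangles. *)
Lemma independent_fubini d1 d2 (T1 : measurableType d1) (T2 : measurableType d2)
    (X : T -> T1) (Y : T -> T2) (f : T1 * T2 -> \bar R) :
  measurable_fun setT X -> measurable_fun setT Y ->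
  (forall A B, measurable A -> measurable B ->
     P (X @^-1` A `&` Y @^-1` B) = (P (X @^-1` A) * P (Y @^-1` B))%E) ->
  measurable_fun setT f -> (forall z, 0 <= f z)%E ->
  (\int[P]_w f (X w, Y w) = \int[P]_w \int[P]_w' f (X w, Y w'))%E.
Proof.
move=> mX mY XY mf f0.
pose X' : {mfun T >-> T1} := HB.pack X (isMeasurableFun.Build _ _ _ _ X mX).
pose Y' : {mfun T >-> T2} := HB.pack Y (isMeasurableFun.Build _ _ _ _ Y mY).
have mZ : measurable_fun setT (fun w => (X w, Y w)).
  exact: measurable_fun_pair.
pose Z' : {mfun T >-> (T1 * T2)%type} :=
  HB.pack (fun w => (X w, Y w)) (isMeasurableFun.Build _ _ _ _ _ mZ).
pose m1 : probability T1 R := distribution P X'.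
pose m2 : probability T2 R := distribution P Y'.
have -> : (\int[P]_w f (X w, Y w) = \int[distribution P Z']_z f z)%E.
  by rewrite ge0_integral_distribution.
have -> : (\int[distribution P Z']_z f z = \int[(m1 \x m2)%E]_z f z)%E.
  apply: eq_measure_integral => A mA _; apply/esym.
  exact: product_measure_unique.
rewrite (fubini_tonelli1 f)// /fubini_F.
have mF := measurable_fun_fubini_tonelli_F (m2 := m2) f mf f0.
rewrite (ge0_integral_distribution X')//; last first.
  by move=> y; apply: integral_ge0.
apply: eq_integral => w _ /=.
rewrite (ge0_integral_distribution Y')//.
exact: (measurableT_comp mf (pair1_measurable _)).
Qed.

Lemma measurable_fun_integral_snd d1 d2 (T1 : measurableType d1)
    (T2 : measurableType d2) (X : T -> T1) (Y : T -> T2)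
    (f : T1 * T2 -> \bar R) :
  measurable_fun setT X -> measurable_fun setT Y ->
  measurable_fun setT f -> (forall z, 0 <= f z)%E ->
  measurable_fun setT (fun w => \int[P]_w' f (X w, Y w'))%E.
Proof.
move=> mX mY mf f0.
pose Y' : {mfun T >-> T2} := HB.pack Y (isMeasurableFun.Build _ _ _ _ Y mY).
have mF := measurable_fun_fubini_tonelli_F (m2 := distribution P Y') f mf f0.
apply: eq_measurable_fun (measurableT_comp mF mX) => w _.
rewrite /= /fubini_F (ge0_integral_distribution Y')//.
exact: (measurableT_comp mf (pair1_measurable _)).
Qed.

(** For fixed [B], both sides are finite measures in [A] that agree on a
    pi-system. *)
Lemma independent_of_pi_system d2 (T2 : measurableType d2) (Y : T -> T2)
    (G : set (set T)) :
  G `<=` measurable -> setI_closed G -> G setT -> measurable_fun setT Y ->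
  (forall A B, G A -> measurable B ->
     P (A `&` Y @^-1` B) = (P A * P (Y @^-1` B))%E) ->
  forall A B, <<s G >> A -> measurable B ->
     P (A `&` Y @^-1` B) = (P A * P (Y @^-1` B))%E.
Proof.
move=> Gm GI GT mY GY A B GA mB.
have mYB : measurable (Y @^-1` B) by rewrite -[X in measurable X]setTI; exact:
  mY.
have PY0 : 0 <= fine (P (Y @^-1` B)) by rewrite fine_ge0.
have Pfin : P (Y @^-1` B) \is a fin_num by exact: fin_num_measure.
pose m1 : {measure set T -> \bar R} := mrestr P mYB.
pose m2 : {measure set T -> \bar R} := mscale (NngNum PY0) P.
have m2E D : m2 D = (P D * P (Y @^-1` B))%E.
  by rewrite muleC -[in RHS](fineK Pfin).
rewrite -m2E -[LHS]/(m1 A).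
apply: (g_sigma_algebra_measure_unique G Gm (fun _ : nat => setT)) GA => //.
- by apply/seteqP; split => // w _; exists 0%N.
- by move=> D GD; rewrite m2E -GY.
- by move=> _; rewrite ltey_eq fin_num_measure.
Qed.

End Independence.

Section UnitaryIndependence.
Context {R : realType} {d : measure_display} {T : measurableType d}.
Context (P : probability T R).
Local Notation C := R[i].
Variables (k n : nat) (U : 'I_k -> T -> 'M[C]_n).
Hypothesis hU : forall i, haar_unitary P (U i).
Hypothesis indepU : mutually_independent P U.

(** The events generating the sigma-algebra of all the [U i] with [i != j]. *)
Definition events_off (j : 'I_k) : set (set T) :=
  [set B | exists2 A : 'I_k -> set 'M[C]_n, (forall i, borel_mx (A i)) &
     B = [set w | forall i, i != j -> A i (U i w)]].

Lemma borel_mxI (A B : set 'M[C]_n) :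
  borel_mx A -> borel_mx B -> borel_mx (A `&` B).
Proof. exact: (@measurableI _ (g_sigma_algebraType (@mx_opens R n))). Qed.

Lemma borel_mxT : borel_mx (setT : set 'M[C]_n).
Proof. exact: (@measurableT _ (g_sigma_algebraType (@mx_opens R n))). Qed.

Lemma measurable_forall_mx (J : {set 'I_k}) (A : 'I_k -> set 'M[C]_n) :
  (forall i, borel_mx (A i)) ->
  measurable [set w | forall i, i \in J -> A i (U i w)].
Proof.
move=> mA.
have -> : [set w | forall i, i \in J -> A i (U i w)] =
          \bigcap_(i in [set i | i \in J]) U i @^-1` A i.
  by apply/seteqP; split => w /= Aw i; [exact: Aw|move=> iJ; exact: Aw].
apply: fin_bigcap_measurable => // i _.
exact: (haar_measurable (hU i)).
Qed.

Lemma events_off_measurable j : events_off j `<=` measurable.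
Proof.
move=> _ [A mA ->].
have := measurable_forall_mx (~: [set j]) mA; congr measurable.
by apply/seteqP; split => w /= Aw i; have := Aw i; rewrite !inE.
Qed.

Lemma events_off_setI j : setI_closed (events_off j).
Proof.
move=> _ _ [A mA ->] [B mB ->]; exists (fun i => A i `&` B i).
  by move=> i; exact: borel_mxI.
apply/seteqP; split => w /=; first by move=> [Aw Bw] i ij; split; auto.
by move=> AB; split => i /AB [].
Qed.

Lemma events_off_setT j : events_off j setT.
Proof. by exists (fun=> setT) => [i|]; [exact: borel_mxT|exact/seteqP]. Qed.

Lemma events_off_independent j A B : events_off j A -> borel_mx B ->
  P (A `&` U j @^-1` B) = (P A * P (U j @^-1` B))%E.
Proof.
move=> [D mD ->] mB.
(* Independence is applied to all indices, and to all indices but [j]. *)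
pose E i := if i == j then B else D i.
have mE i : borel_mx (E i) by rewrite /E; case: ifP.
have := indepU [set: 'I_k]%SET mE; rewrite (bigD1 j) ?inE//=.
have := indepU (~: [set j])%SET mE.
rewrite /E eqxx.
have -> : [set w | forall i, i \in (~: [set j])%SET ->
             (if i == j then B else D i) (U i w)] =
          [set w | forall i, i != j -> D i (U i w)].
  apply/seteqP; split => w /= Dw i; have := Dw i; rewrite !inE.
    by case: (i == j).
  by case: (i == j).
have -> : [set w | forall i, i \in [set: 'I_k]%SET ->
             (if i == j then B else D i) (U i w)] =
          [set w | forall i, i != j -> D i (U i w)] `&` U j @^-1` B.
  apply/seteqP; split => w /=.
    move=> Ew; split; last by have := Ew j; rewrite inE eqxx; exact.
    by move=> i ij; have := Ew i; rewrite inE (negbTE ij); exact.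
  by move=> [Dw Bw] i _; case: eqP => [->//|/eqP]; exact: Dw.
move=> -> ->; rewrite muleC; congr (_ * _)%E.
by apply: eq_bigl => i; rewrite !inE.
Qed.

Lemma measurable_off j i : i != j ->
  @measurable_fun _ _ (g_sigma_algebraType (events_off j))
    (g_sigma_algebraType (@mx_opens R n)) setT (U i).
Proof.
move=> ij _ B mB; rewrite setTI; apply: sub_sigma_algebra.
exists (fun l => if l == i then B else setT).
  by move=> l; case: ifP => // _; exact: borel_mxT.
apply/seteqP; split => w /=; first by move=> Bw l _; case: eqP => [->|].
by move=> /(_ i ij); rewrite eqxx.
Qed.

(** Integrating out [U j]: the vector [v] only depends on the other unitaries,
    so that [haar_mgf] applies to it as if it were constant. *)
Lemma integrate_out (j : 'I_k) (x : 'cV[C]_n)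
    (F : g_sigma_algebraType (events_off j) -> R)
    (v : g_sigma_algebraType (events_off j) -> 'cV[C]_n) :
  (0 < n)%N -> rip x x <= 1 -> measurable_fun setT F -> measurable_vec v ->
  (\int[P]_w (expR (F w + n%:R * rip (U j w *m x) (v w)))%:E <=
   \int[P]_w (expR (F w + 2 * n%:R * rip (v w) (v w)))%:E)%E.
Proof.
move=> n0 x1 mF mv.
pose T1 : measurableType _ := g_sigma_algebraType (events_off j).
pose T2 : measurableType _ := g_sigma_algebraType (@mx_opens R n).
have midT : @measurable_fun _ _ T T1 setT id.
  move=> _ A mA; rewrite setTI; apply: smallest_sub mA.
    exact: sigma_algebra_measurable.
  exact: events_off_measurable.
have mU : @measurable_fun _ _ T T2 setT (U j) by exact: haar_measurable_fun.
have mF' : @measurable_fun _ _ T _ setT F := measurableT_comp mF midT.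
have mv' : @measurable_vec R _ T _ v := measurable_vec_comp midT mv.
pose f (z : T1 * T2) : \bar R :=
  (expR (F z.1 + n%:R * rip ((z.2 : 'M[C]_n) *m x) (v z.1)))%:E.
have mf : measurable_fun setT f.
  apply/measurable_EFinP; apply: measurableT_comp; first exact: measurable_expR.
  apply: measurable_funD; first exact: (measurableT_comp mF measurable_fst).
  apply: measurable_funM; first exact: measurable_cst.
  apply: measurable_rip.
    exact: (measurable_vec_comp measurable_snd (measurable_vec_mulmx x)).
  exact: (measurable_vec_comp measurable_fst mv).
have f0 z : (0 <= f z)%E by rewrite lee_fin expR_ge0.
have indep A B : @measurable _ T1 A -> @measurable _ T2 B ->
    P ((id : T -> T1) @^-1` A `&` U j @^-1` B) =
    (P ((id : T -> T1) @^-1` A) * P (U j @^-1` B))%E.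
  move=> mA mB; apply: independent_of_pi_system mA mB => //.
  - exact: events_off_measurable.
  - exact: events_off_setI.
  - exact: events_off_setT.
  - exact: events_off_independent.
have fub := independent_fubini (X := (id : T -> T1)) (Y := (U j : T -> T2))
  midT mU indep mf f0.
apply: (@le_trans _ _ (\int[P]_w \int[P]_w' f (w, U j w'))%E).
  by rewrite le_eqVlt; apply/orP; left; apply/eqP; exact: fub.
have mG : measurable_fun setT
    (fun w : T => (expR (F w + 2 * n%:R * rip (v w) (v w)))%:E).
  apply/measurable_EFinP; apply: measurableT_comp; first exact: measurable_expR.
  apply: measurable_funD => //.
  by apply: measurable_funM; [exact: measurable_cst|exact: measurable_rip].
have inner (w : T) : (\int[P]_w' f (w, U j w') <=
    (expR (F w + 2 * n%:R * rip (v w) (v w)))%:E)%E.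
  rewrite /f /=.
  under eq_integral do rewrite expRD EFinM.
  have mh : measurable_fun setT
      (fun w' => (expR (n%:R * rip (U j w' *m x) (v w)))%:E).
    apply/measurable_EFinP; apply: measurableT_comp.
      exact: measurable_expR.
    apply: measurable_funM; first exact: measurable_cst.
    apply: measurable_rip; first exact: (haar_measurable_vec _ (hU j)).
    exact: measurable_vec_cst.
  rewrite ge0_integralZl_EFin ?expR_ge0//.
  rewrite expRD EFinM lee_pmul2l ?lte_fin ?expR_gt0//.
  exact: haar_mgf.
apply: ge0_le_integral => //.
- by move=> w _; apply: integral_ge0 => w' _; exact: f0.
- have := measurable_fun_integral_snd (X := (id : T -> T1)) P midT mU mf f0.
  exact.
Qed.

End UnitaryIndependence.

(** * Gram forms and the elimination of an index *)

Section Coefficients.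
Context {R : realType}.
Local Notation C := R[i].

Lemma rip_CauchySchwarz n (u v : 'cV[C]_n) :
  rip u v ^+ 2 <= rip u u * rip v v.
Proof.
have [u0|u0] := eqVneq (rip u u) 0.
  by rewrite (rip_eq0 u0) !rip0l expr0n mul0r.
have u1 : 0 < rip u u by rewrite lt_def u0 rip_ge0.
have := rip_ge0 ((rip u u)%:C%C *: v - (rip u v)%:C%C *: u).
rewrite !(ripDl, ripDr, ripNl, ripNr, ripZl, ripZr) (ripC v u) => h.
rewrite -subr_ge0 -(pmulr_rge0 _ u1); apply: le_trans h _.
move: (rip u u) (rip v v) (rip u v) => a b c.
by rewrite le_eqVlt; apply/orP; left; apply/eqP; ring.
Qed.

Definition sqn (z : C) : R := complex.Re z ^+ 2 + complex.Im z ^+ 2.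

Lemma sqn_ge0 z : 0 <= sqn z.
Proof. by rewrite addr_ge0// sqr_ge0. Qed.

Lemma sqn0 : sqn 0 = 0.
Proof. by rewrite /sqn /= expr0n addr0. Qed.

Lemma sqnM a b : sqn (a * b) = sqn a * sqn b.
Proof. by rewrite /sqn complexReM complexImM; ring. Qed.

Lemma sqn_conj a : sqn (Num.conj a) = sqn a.
Proof. by rewrite /sqn complexRe_conj complexIm_conj sqrrN. Qed.

Lemma sqnD a b : sqn (a + b) <= 2 * (sqn a + sqn b).
Proof.
rewrite /sqn complexReD complexImD.
have := sqr_ge0 (complex.Re a - complex.Re b).
have := sqr_ge0 (complex.Im a - complex.Im b).
nra.
Qed.

Lemma conj_mul_sqn (a : C) : Num.conj a * a = (sqn a)%:C%C.
Proof.
apply/eqP; rewrite eq_complex complexReM complexImM complexRe_conj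
  complexIm_conj.
by rewrite /= /sqn; apply/andP; split; apply/eqP; ring.
Qed.

(** Squared Hilbert-Schmidt norm. *)
Definition hs m n (c : 'M[C]_(m, n)) : R := rip (mxvec c)^T (mxvec c)^T.

(** Matrices are treated as vectors through [mxvec], so that the Hilbert-Schmidt
    inner product inherits the Cauchy-Schwarz inequality from [rip]. *)
Lemma rip_mxvec m n (a b : 'M[C]_(m, n)) : rip (mxvec a)^T (mxvec b)^T =
  \sum_p \sum_q (complex.Re (a p q) * complex.Re (b p q) +
                 complex.Im (a p q) * complex.Im (b p q)).
Proof.
rewrite ripE (reindex _ (curry_mxvec_bij m n)) pair_bigA /=.
by apply: eq_bigr => -[p q] _; rewrite !mxE /= !mxvecE.
Qed.

Lemma hsE m n (c : 'M[C]_(m, n)) : hs c = \sum_p \sum_q sqn (c p q).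
Proof.
rewrite /hs rip_mxvec; apply: eq_bigr => p _; apply: eq_bigr => q _.
by rewrite /sqn !expr2.
Qed.

Lemma hs_ge0 m n (c : 'M[C]_(m, n)) : 0 <= hs c.
Proof. exact: rip_ge0. Qed.

(** The cross term is at most [4 * (1 / 32) * 2 s = s / 4] by
    Cauchy-Schwarz. *)
Lemma hsD2 m n (a b : 'M[C]_(m, n)) (s : R) : 0 <= s ->
  hs a <= (1 / 32) ^+ 2 -> hs b <= (2 * s) ^+ 2 ->
  hs (a + b + b) <= hs a + s / 4 + 16 * s ^+ 2.
Proof.
move=> s0 ha hb; rewrite /hs !linearD /= !(ripDl, ripDr).
rewrite -/(hs a) -/(hs b).
have := rip_CauchySchwarz (mxvec a)^T (mxvec b)^T.
rewrite -/(hs a) -/(hs b) [rip (mxvec b)^T (mxvec a)^T]ripC.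
set X := rip _ _ => XX.
have X2 : X ^+ 2 <= (s / 16) ^+ 2.
  apply: le_trans XX _.
  apply: le_trans (ler_pM (hs_ge0 a) (hs_ge0 b) ha hb) _.
  by rewrite le_eqVlt; apply/orP; left; apply/eqP; field.
have X1 : X <= s / 16.
  rewrite leNgt; apply: contraTN X2 => sX.
  rewrite -ltNge ltr_pXn2r ?nnegrE ?divr_ge0//.
  by apply: le_trans (ltW sX); rewrite divr_ge0.
by move: (hs a) (hs b) (X) hb X1 => A B Y hb X1 {X2 XX ha}; lra.
Qed.

(** The real part of the sum of [c p q <u p, u q>]. *)
Definition gram_form n k (c : 'M[C]_k) (u : 'I_k -> 'cV[C]_n) : R :=
  \sum_p \sum_q rip (u p) (c p q *: u q).

Lemma gram_formD n k (c c' : 'M[C]_k) (u : 'I_k -> 'cV[C]_n) :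
  gram_form (c + c') u = gram_form c u + gram_form c' u.
Proof.
rewrite /gram_form -big_split; apply: eq_bigr => p _; rewrite -big_split.
by apply: eq_bigr => q _; rewrite mxE scalerDl ripDr.
Qed.

End Coefficients.

Section GramElimination.
Context {R : realType}.
Local Notation C := R[i].
Variables (n k : nat) (c : 'M[C]_k) (j : 'I_k).
Hypothesis diag0 : forall p, c p p = 0.

(** [erase_index], [link] and [link_gram] decompose the Gram form of [c] with
    respect to the vector of index [j]: the part without it, the coefficients
    of the vector [v] that it is paired with, and the off-diagonal coefficients
    of [|v| ^ 2]. [link_norm] is the mass of row and column [j]. *)
Definition erase_index : 'M[C]_k :=
  \matrix_(p, q) if (p == j) || (q == j) then 0 else c p q.

Definition link p : C := if p == j then 0 else c j p + Num.conj (c p j).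

Definition link_gram : 'M[C]_k :=
  \matrix_(p, q) if p == q then 0 else Num.conj (link p) * link q.

Definition link_norm : R := \sum_(p | p != j) (sqn (c j p) + sqn (c p j)).

(** The entries of row [j] and of column [j] contribute real parts of
    conjugate expressions, so they merge into a single pairing. *)
Lemma gram_form_split (u : 'I_k -> 'cV[C]_n) :
  gram_form c u = gram_form erase_index u + rip (u j) (\sum_q link q *: u q).
Proof.
rewrite /gram_form (bigD1 j)//= [in RHS](bigD1 j)//=.
rewrite [X in _ = X + _ + _]big1 ?add0r; last first.
  by move=> q _; rewrite mxE eqxx scale0r rip0r.
rewrite rip_sumr [X in _ = _ + X](bigD1 j)//= {1}/link eqxx scale0r rip0r add0r.
rewrite (bigD1 j)//= diag0 scale0r rip0r add0r.
have -> : \sum_(i < k | i != j) \sum_q rip (u i) (c i q *: u q) =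
  \sum_(i < k | i != j) \sum_q rip (u i) (erase_index i q *: u q) +
  \sum_(i < k | i != j) rip (u i) (c i j *: u j).
  rewrite -big_split; apply: eq_bigr => i ij /=.
  rewrite (bigD1 j)//= [in RHS](bigD1 j)//= mxE eqxx orbT scale0r rip0r add0r.
  rewrite addrC; congr (_ + _); apply: eq_bigr => q qj.
  by rewrite mxE (negbTE ij) (negbTE qj).
rewrite addrCA; congr (_ + _); rewrite -big_split; apply: eq_bigr => q qj /=.
by rewrite /link (negbTE qj) scalerDl ripDr [rip (u q) _]ripC rip_conjZ.
Qed.

(** The diagonal terms are split off because the vectors of interest have
    constant length, so that they only contribute a constant. *)
Lemma link_sum_norm (u : 'I_k -> 'cV[C]_n) :
  rip (\sum_q link q *: u q) (\sum_q link q *: u q) =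
  gram_form link_gram u + \sum_p sqn (link p) * rip (u p) (u p).
Proof.
rewrite rip_suml -big_split; apply: eq_bigr => p _ /=.
rewrite rip_sumr (bigD1 p)//= addrC [in RHS](bigD1 p)//= mxE eqxx scale0r rip0r
  add0r.
congr (_ + _); last by rewrite rip_conjZ scalerA conj_mul_sqn ripZr.
apply: eq_bigr => q qp; rewrite mxE eq_sym (negbTE qp).
by rewrite rip_conjZ scalerA.
Qed.

Lemma link_norm_ge0 : 0 <= link_norm.
Proof. by apply: sumr_ge0 => p _; rewrite addr_ge0 ?sqn_ge0. Qed.

Lemma hs_erase_index : hs c = hs erase_index + link_norm.
Proof.
rewrite !hsE (bigD1 j)//= [in RHS](bigD1 j)//=.
rewrite [X in _ = X + _ + _]big1 ?add0r; last first.
  by move=> q _; rewrite mxE eqxx sqn0.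
rewrite (bigD1 j)//= diag0 sqn0 add0r.
have -> : link_norm = \sum_(p | p != j) sqn (c j p) +
                      \sum_(p | p != j) sqn (c p j) by rewrite -big_split.
rewrite [RHS]addrCA; congr (_ + _).
rewrite -big_split; apply: eq_bigr => p pj /=.
rewrite (bigD1 j)//= [in RHS](bigD1 j)//= mxE eqxx orbT sqn0 add0r addrC.
congr (_ + _); apply: eq_bigr => q qj.
by rewrite mxE (negbTE pj) (negbTE qj).
Qed.

Lemma sum_link_le : \sum_p sqn (link p) <= 2 * link_norm.
Proof.
rewrite (bigD1 j)//= /link eqxx sqn0 add0r mulr_sumr; apply: ler_sum => p pj.
by rewrite (negbTE pj); apply: le_trans (sqnD _ _) _; rewrite sqn_conj.
Qed.

Lemma hs_link_gram : hs link_gram <= (2 * link_norm) ^+ 2.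
Proof.
apply: le_trans (_ : (\sum_p sqn (link p)) ^+ 2 <= _); last first.
  rewrite ler_pXn2r ?sum_link_le// nnegrE.
    by apply: sumr_ge0 => p _; exact: sqn_ge0.
  by rewrite mulr_ge0 ?link_norm_ge0.
rewrite hsE expr2 mulr_suml; apply: ler_sum => p _.
rewrite mulr_sumr; apply: ler_sum => q _; rewrite mxE.
case: eqP => _; first by rewrite sqn0 mulr_ge0 ?sqn_ge0.
by rewrite sqnM sqn_conj.
Qed.

(** Erasing [j] removes [link_norm] from the squared norm, and adding
    [2 link_gram] returns at most half of it; the other half pays for the
    diagonal terms of [link_sum_norm]. *)
Lemma hs_eliminated : hs c <= (1 / 32) ^+ 2 ->
  hs (erase_index + link_gram + link_gram) <= hs erase_index + link_norm / 2.
Proof.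
have := hs_erase_index; have := link_norm_ge0; have := hs_ge0 erase_index.
move=> h0 l0 cE c1.
have h1 : hs erase_index <= (1 / 32) ^+ 2.
  by apply: le_trans c1; rewrite cE lerDl.
have l1 : link_norm <= (1 / 32) ^+ 2 by apply: le_trans c1; rewrite cE lerDr.
apply: le_trans (hsD2 l0 h1 hs_link_gram) _; rewrite -addrA lerD2l.
move: link_norm l0 l1 => s s0 s1 {h0 cE c1 h1}.
have : s ^+ 2 <= s / 64 by rewrite expr2 ler_wpM2l//; lra.
lra.
Qed.

End GramElimination.

(** * The exponential moment of a Gram form *)

Section GramMgf.
Context {R : realType} {d : measure_display} {T : measurableType d}.
Context (P : probability T R).
Local Notation C := R[i].
Variables (k n : nat) (U : 'I_k -> T -> 'M[C]_n) (x : 'cV[C]_n).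
Hypothesis hU : forall i, haar_unitary P (U i).
Hypothesis indepU : mutually_independent P U.
Hypothesis n_gt0 : (0 < n)%N.
Hypothesis x_le1 : rip x x <= 1.

Let u (w : T) (p : 'I_k) : 'cV[C]_n := U p w *m x.

Lemma measurable_gram_form (c : 'M[C]_k) :
  measurable_fun setT (fun w => gram_form c (u w)).
Proof.
apply: measurable_sum => p; apply: measurable_sum => q.
apply: measurable_rip; first exact: (haar_measurable_vec _ (hU p)).
exact: (measurable_vecZ _ (haar_measurable_vec _ (hU q))).
Qed.

Let measurable_off_vec (j q : 'I_k) : q != j ->
  @measurable_vec R _ (g_sigma_algebraType (events_off U j)) n (u^~ q).
Proof.
move=> qj.
exact: (measurable_vec_comp (measurable_off (U := U) qj)
  (measurable_vec_mulmx x)).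
Qed.

Lemma gram_mgf_eliminate (c : 'M[C]_k) (j : 'I_k) : (forall p, c p p = 0) ->
  (\int[P]_w (expR (n%:R * gram_form c (u w)))%:E <=
   (expR (4 * n%:R * link_norm c j))%:E *
   \int[P]_w (expR (n%:R *
     gram_form (erase_index c j + link_gram c j + link_gram c j) (u w)))%:E)%E.
Proof.
move=> diag0.
pose T1 : measurableType _ := g_sigma_algebraType (events_off U j).
pose F (w : T1) := n%:R * gram_form (erase_index c j) (u w).
pose v (w : T1) := \sum_q link c j q *: u w q.
have mv : measurable_vec v.
  apply: measurable_vec_sum => q; have [->|qj] := eqVneq q j.
    rewrite /link eqxx (_ : (fun _ => _) = fun=> 0).
      exact: measurable_vec_cst.
    by apply/funext => w; rewrite scale0r.
  exact/measurable_vecZ/measurable_off_vec.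
have mF : measurable_fun setT F.
  apply: measurable_funM; first exact: measurable_cst.
  apply: measurable_sum => p; apply: measurable_sum => q.
  rewrite mxE; case: ifPn => [_|/norP[pj qj]].
    rewrite (_ : (fun _ => _) = fun=> 0); first exact: measurable_cst.
    by apply/funext => w; rewrite scale0r rip0r.
  by apply: measurable_rip; [|apply: measurable_vecZ]; exact:
    measurable_off_vec.
have FvE w : F w + n%:R * rip (U j w *m x) (v w) = n%:R * gram_form c (u w).
  rewrite /F /v /=.
  rewrite [in RHS](@gram_form_split R n k c j diag0 (u w)).
  rewrite [RHS]mulrDr.
  reflexivity.
have eqI : (\int[P]_w (expR (n%:R * gram_form c (u w)))%:E =
           \int[P]_w (expR (F w + n%:R * rip (U j w *m x) (v w)))%:E)%E.
  apply: eq_integral => w _.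
  rewrite FvE.
  reflexivity.
have io := integrate_out hU indepU n_gt0 x_le1 mF mv.
apply: (le_trans _ (le_trans io _)).
  by rewrite le_eqVlt; apply/orP; left; apply/eqP; exact: eqI.
have mexp c' : measurable_fun setT
    (fun w => (expR (n%:R * gram_form c' (u w)))%:E).
  apply/measurable_EFinP; apply: measurableT_comp; first exact: measurable_expR.
  by apply: measurable_funM; [exact: measurable_cst|exact:
    measurable_gram_form].
rewrite -ge0_integralZl_EFin ?expR_ge0//.
have mid : @measurable_fun _ _ T T1 setT id.
  move=> _ A mA; rewrite setTI; apply: smallest_sub mA.
    exact: sigma_algebra_measurable.
  exact: events_off_measurable.
apply: ge0_le_integral => //.
- apply/measurable_EFinP; apply: measurableT_comp; first exact: measurable_expR.
  apply: measurable_funD; first exact: (measurableT_comp mF mid).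
  apply: measurable_funM; first exact: measurable_cst.
  have := measurableT_comp (measurable_rip mv mv) mid; exact.
- by apply: emeasurable_funM; [exact: measurable_cst|exact: mexp].
move=> w _; rewrite -EFinM lee_fin -expRD ler_expR /F /v link_sum_norm.
rewrite !gram_formD.
suff : \sum_p sqn (link c j p) * rip (u w p) (u w p) <= 2 * link_norm c j.
  set S := \sum_p _; set G := gram_form (link_gram c j) _.
  set E := gram_form (erase_index c j) _; set L := link_norm c j => SL.
  have : 0 <= n%:R * (2 * L - S) by rewrite mulr_ge0// subr_ge0.
  by move: (n%:R) => N; lra.
apply: le_trans (sum_link_le c j); apply: ler_sum => p _.
by rewrite ler_piMr ?sqn_ge0// /u (haar_norm _ _ (hU p)).
Qed.

(** Induction on the number [m] of indices still present.  One step costs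
    a factor [exp (4 n L)] with [L = link_norm c j] and lowers [hs] by at least
    [L / 2], whence the constant [8]. *)
Lemma gram_mgf_support (m : nat) (c : 'M[C]_k) : (forall p, c p p = 0) ->
  (forall p q : 'I_k, (m <= p)%N || (m <= q)%N -> c p q = 0) ->
  hs c <= (1 / 32) ^+ 2 ->
  (\int[P]_w (expR (n%:R * gram_form c (u w)))%:E <=
     (expR (8 * n%:R * hs c))%:E)%E.
Proof.
elim: m c => [|m IH] c diag0 supp small.
  have -> : c = 0 by apply/matrixP => p q; rewrite supp ?leq0n// mxE.
  have g0 w : gram_form 0 (u w) = 0.
    by rewrite /gram_form big1// => p _; rewrite big1// => q _;
      rewrite mxE scale0r rip0r.
  under eq_integral do rewrite g0 mulr0 expR0.
  rewrite integral_cst// mul1e [X in (X <= _)%E](@probability_setT _ _ _ P).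
  by rewrite lee_fin -expR0 ler_expR !mulr_ge0// hs_ge0.
have [mk|km] := ltnP m k; last first.
  apply: IH => // p q pq; apply: supp.
  by case/orP: pq => [mp|mq]; [have := ltn_ord p|have := ltn_ord q];
    rewrite ltnNge (leq_trans km).
pose j := Ordinal mk.
apply: le_trans (gram_mgf_eliminate j diag0) _.
have hs' := hs_eliminated j diag0 small.
have hsc := hs_erase_index j diag0.
have l0 := link_norm_ge0 c j.
set c' := erase_index c j + _ + _ in hs' *.
apply: (@le_trans _ _ ((expR (4 * n%:R * link_norm c j))%:E *
                       (expR (8 * n%:R * hs c'))%:E)%E).
  rewrite lee_pmul2l ?lte_fin ?expR_gt0//; apply: IH.
  - by move=> p; rewrite !mxE eqxx diag0 if_same !addr0.
  - move=> p q pq.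
    have lp (r : 'I_k) : (m <= r)%N -> link c j r = 0.
      rewrite leq_eqVlt /link -val_eqE /= eq_sym => /orP[->//|mr].
      by case: eqP => // _; rewrite !supp ?mr ?orbT// rmorph0 addr0.
    have -> : c' p q = erase_index c j p q.
      rewrite !mxE; case: (p == q); first by rewrite !addr0.
      by case/orP: pq => /lp ->; rewrite ?rmorph0 ?mul0r ?mulr0 !addr0.
    rewrite mxE; case: ifPn => // /norP[]; rewrite -!val_eqE /= => pj qj.
    apply: supp; move: pq; rewrite (leq_eqVlt m p) (leq_eqVlt m q) ![m ==
      _]eq_sym.
    by rewrite (negbTE pj) (negbTE qj).
  - by apply: le_trans hs' (le_trans _ small); rewrite hsc lerD2l; lra.
rewrite -EFinM lee_fin -expRD ler_expR.
rewrite -subr_ge0 hsc.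
rewrite (_ : _ - _ = 8 * (n%:R * (hs (erase_index c j) + link_norm c j / 2 - hs
  c'))).
  by rewrite !mulr_ge0// subr_ge0.
by field.
Qed.

Lemma gram_mgf (c : 'M[C]_k) : (forall p, c p p = 0) ->
  hs c <= (1 / 32) ^+ 2 ->
  (\int[P]_w (expR (n%:R * gram_form c (u w)))%:E <= (expR n%:R)%:E)%E.
Proof.
move=> diag0 small; have n0 : 0 <= n%:R :> R by [].
apply: le_trans (gram_mgf_support (m := k) diag0 _ small) _.
  by move=> p q; rewrite leqNgt ltn_ord /= leqNgt ltn_ord.
rewrite lee_fin ler_expR -mulrA mulrCA ler_piMr//; lra.
Qed.

(** Markov's inequality for the exponential moment. *)
Lemma gram_tail (c : 'M[C]_k) (s : R) : (forall p, c p p = 0) ->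
  hs c <= (1 / 32) ^+ 2 ->
  (P [set w | (s <= gram_form c (u w))%R] <= (expR (n%:R * (1 - s)))%:E)%E.
Proof.
move=> diag0 small.
pose X : {RV P >-> R} := HB.pack (fun w => gram_form c (u w))
  (isMeasurableFun.Build _ _ _ _ _ (measurable_gram_form c)).
have nR : 0 < n%:R :> R by rewrite ltr0n.
have := chernoff X s nR; rewrite /= => /le_trans; apply.
rewrite /mmt_gen_fun unlock /=.
under eq_integral do rewrite mulrC.
apply: (@le_trans _ _ ((expR n%:R)%:E * (expR (- (n%:R * s)))%:E)%E).
  by rewrite lee_pmul2r ?lte_fin ?expR_gt0//; exact: gram_mgf.
by rewrite -EFinM lee_fin -expRD mulrBr mulr1.
Qed.

End GramMgf.

(** * Nets of Euclidean balls *)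

Section Net.
Context {R : realType}.

Lemma sum_half_le (L : nat) : \sum_(a < L) (1 / 2 : R) ^+ a <= 2.
Proof.
suff -> : \sum_(a < L) (1 / 2 : R) ^+ a = 2 - 2 * (1 / 2) ^+ L.
  by rewrite gerBl mulr_ge0// exprn_ge0// divr_ge0.
elim: L => [|L IH]; first by rewrite big_ord0 expr0 mulr1 subrr.
by rewrite big_ord_recr /= IH exprS; field.
Qed.

(** Giving the point [z] the weight [2 ^- (sum of z)] makes the total weight
    a product of geometric series. *)
Lemma card_sum_le (I : finType) (L M : nat) :
  (#|[set z : {ffun I -> 'I_L} | \sum_i (z i : nat) <= M]%SET| <=
     2 ^ M * 2 ^ #|I|)%N.
Proof.
rewrite -(ler_nat R) natrM !natrX -sum1_card natr_sum.
apply: le_trans (_ : \sum_(z : {ffun I -> 'I_L})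
    2 ^+ M * \prod_i (1 / 2 : R) ^+ (z i) <= _).
  rewrite [leRHS](bigID [in [set z : {ffun I -> 'I_L} |
    (\sum_i (z i : nat) <= M)%N]%SET]) /=.
  rewrite -[leLHS]addr0; apply: lerD; last first.
    apply: sumr_ge0 => z _; apply: mulr_ge0; first by rewrite exprn_ge0.
    by apply: prodr_ge0 => i _; rewrite exprn_ge0// divr_ge0.
  apply: ler_sum => z; rewrite inE => zM.
  rewrite prodrXr -{1}(subnKC zM) exprD mulrAC -exprMn mul1r divff// expr1n
    mul1r.
  by rewrite exprn_ege1// ler1n.
rewrite -mulr_sumr -(bigA_distr_bigA (fun _ (a : 'I_L) => (1 / 2 : R) ^+ a)).
rewrite ler_pM2l ?exprn_gt0// -prodr_const; apply: ler_prod => i _.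
by rewrite sum_half_le andbT; apply: sumr_ge0 => a _; rewrite exprn_ge0//
  divr_ge0.
Qed.

(** The lattice of step [1 / (4 sqrt m)], where [m] is the dimension.  Rounding
    towards zero keeps its points inside the ball, and the absolute values [z]
    of the integer coordinates satisfy [sum z <= sum z ^ 2 <= 16 m], so that
    [card_sum_le] counts them; the signs account for another [2 ^ m]. *)
Lemma unit_ball_net (I : finType) :
  exists2 N : seq {ffun I -> R}, (size N <= 2 ^ (18 * #|I|))%N &
    (forall y, y \in N -> \sum_i y i ^+ 2 <= 1) /\
    (forall x : I -> R, \sum_i x i ^+ 2 <= 1 ->
       exists2 y, y \in N & \sum_i (x i - y i) ^+ 2 <= 1 / 16).
Proof.
have [I0|I_gt0] := posnP #|I|.
  exists [:: [ffun=> 0]]; first by rewrite I0 muln0.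
  split=> [y _|x _].
    by rewrite big1 ?ler01// => i _; have := fintype0 i I0.
  exists [ffun=> 0]; first by rewrite mem_head.
  by rewrite big1 ?divr_ge0// => i _; have := fintype0 i I0.
set m := #|I| in I_gt0 *.
have mR : 0 < m%:R :> R by rewrite ltr0n.
have [de de0 de2] : exists2 de : R, 0 < de & m%:R * de ^+ 2 = 1 / 16.
  exists (1 / (4 * Num.sqrt m%:R)); first by rewrite divr_gt0// mulr_gt0//
    sqrtr_gt0.
  rewrite expr_div_n exprMn sqr_sqrtr ?ler0n// expr1n.
  by field; rewrite gt_eqF.
pose M := (16 * m)%N.
pose pt (p : {ffun I -> 'I_M.+1} * {ffun I -> bool}) : {ffun I -> R} :=
  [ffun i => (-1) ^+ (p.2 i) * ((p.1 i : nat)%:R * de)].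
pose S := finset.setX
  [set z : {ffun I -> 'I_M.+1} | (\sum_i (z i : nat) <= M)%N]%SET
  [set: {ffun I -> bool}]%SET.
exists [seq y : {ffun I -> R} <- [seq pt p | p <- enum S] | \sum_i y i ^+ 2 <=
  1].
  rewrite size_filter; apply: leq_trans (count_size _ _) _.
  rewrite size_map -cardE cardsX cardsT card_ffun card_bool -/m.
  apply: leq_trans (leq_mul (card_sum_le _ _ _) (leqnn _)) _.
  by rewrite -/m /M -!expnD -!mulSnr.
split=> [y|x x1]; first by rewrite mem_filter => /andP[].
pose z i : nat := Num.truncn (`|x i| / de).
have zP i : (z i)%:R * de <= `|x i| < (z i).+1%:R * de.
  rewrite -ler_pdivlMr// -ltr_pdivrMr//.
  exact/truncn_itv/divr_ge0/ltW.
have zde0 i : 0 <= (z i)%:R * de by rewrite mulr_ge0// ltW.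
have sz : (\sum_i z i <= M)%N.
  rewrite -(ler_nat R) natr_sum.
  apply: le_trans (_ : \sum_i x i ^+ 2 / de ^+ 2 <= _).
    apply: ler_sum => i _.
    rewrite ler_pdivlMr ?exprn_gt0// -(real_normK (num_real (x i))).
    have /andP[zx _] := zP i.
    apply: le_trans (_ : ((z i)%:R * de) ^+ 2 <= _); last first.
      by rewrite ler_pXn2r ?nnegrE ?zde0.
    rewrite exprMn ler_pM2r ?exprn_gt0// -natrX ler_nat.
    by case: (z i) => // a; rewrite expnS leq_pmulr.
  rewrite -mulr_suml ler_pdivrMr ?exprn_gt0//; apply: le_trans x1 _.
  rewrite /M natrM -mulrA de2; lra.
have zM i : (z i < M.+1)%N.
  by rewrite ltnS (leq_trans _ sz)// (bigD1 i)//= leq_addr.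
pose p := ([ffun i => inord (z i) : 'I_M.+1], [ffun i => x i < 0]).
have ptE i : pt p i = (-1) ^+ (x i < 0)%R * ((z i)%:R * de).
  by rewrite !ffunE /= inordK.
have xE i : x i = (-1) ^+ (x i < 0)%R * `|x i|.
  by rewrite -realEsign ?num_real.
have dist i : (x i - pt p i) ^+ 2 <= de ^+ 2.
  have /andP[zx xz] := zP i.
  rewrite ptE [X in X - _]xE -mulrBr exprMn sqrr_sign mul1r.
  rewrite ler_pXn2r ?nnegrE ?subr_ge0// ?ltW//.
  by move: xz; rewrite -natr1 mulrDl mul1r ltrBlDl.
have shrink i : pt p i ^+ 2 <= x i ^+ 2.
  have /andP[zx _] := zP i.
  rewrite ptE [X in _ <= X ^+ 2]xE !exprMn !sqrr_sign !mul1r -exprMn.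
  by rewrite ler_pXn2r ?nnegrE ?zde0.
exists (pt p); last first.
  rewrite -de2 mulr_natl -sumr_const; exact: ler_sum.
rewrite mem_filter; apply/andP; split.
  by apply: le_trans x1; apply: ler_sum.
apply: map_f; rewrite mem_enum !inE /= andbT.
by apply: leq_trans sz; apply: leq_sum => i _; rewrite ffunE inordK.
Qed.

End Net.

(** * From a net to the ball *)

Section ComplexNets.
Context {R : realType}.
Local Notation C := R[i].

Lemma complex_ball_net n :
  exists2 N : seq 'cV[C]_n, (size N <= 2 ^ (36 * n))%N &
    (forall y, y \in N -> rip y y <= 1) /\
    (forall x, rip x x <= 1 ->
       exists2 y, y \in N & rip (x - y) (x - y) <= 1 / 16).
Proof.
have [N sN [N1 Nx]] := @unit_ball_net R ('I_n * bool)%type.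
pose cv (y : {ffun 'I_n * bool -> R}) : 'cV[C]_n :=
  \col_i Complex (y (i, false)) (y (i, true)).
pose co (x : 'cV[C]_n) (ib : 'I_n * bool) : R :=
  if ib.2 then complex.Im (x ib.1 0) else complex.Re (x ib.1 0).
have sumE (f : 'I_n * bool -> R) :
    \sum_ib f ib = \sum_i (f (i, false) + f (i, true)).
  transitivity (\sum_i \sum_b f (i, b)).
    by rewrite pair_bigA; apply: eq_bigr => -[].
  apply: eq_bigr => i _.
  by rewrite big_bool addrC.
exists [seq cv y | y <- N].
  rewrite size_map; apply: leq_trans sN _.
  by rewrite card_prod card_ord card_bool leq_pexp2l// mulnCA mulnC.
split=> [_ /mapP[y yN ->]|x x1].
  apply: le_trans (N1 y yN); rewrite ripE sumE.
  by apply: ler_sum => i _; rewrite !mxE /= -!expr2.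
have [|y yN xy] := Nx (co x).
  apply: le_trans x1; rewrite ripE sumE.
  by apply: ler_sum => i _; rewrite /co /= -!expr2.
exists (cv y); first exact: map_f.
apply: le_trans xy; rewrite ripE sumE; apply: ler_sum => i _.
by rewrite !mxE /co /=; case: (x i 0) => a b /=; rewrite -!expr2.
Qed.

(** Finiteness suffices: [k] stays fixed while [n] grows. *)
Lemma hs_ball_net k : exists N : seq 'M[C]_k,
  (forall c, c \in N -> hs c <= 1) /\
  (forall c, hs c <= 1 -> exists2 c', c' \in N & hs (c - c') <= 1 / 16).
Proof.
have [N _ [N1 Nx]] := complex_ball_net (k * k).
exists [seq vec_mx y^T | y <- N]; split=> [_ /mapP[y yN ->]|c c1].
  by rewrite /hs vec_mxK trmxK; exact: N1.
have [y yN cy] := Nx _ c1; exists (vec_mx y^T); first exact: map_f.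
by rewrite /hs linearB /= vec_mxK linearB /= trmxK.
Qed.

End ComplexNets.

Lemma rip_add_scale {R : realType} n (a : R) (y z : 'cV[R[i]]_n) :
  rip (y + a%:C%C *: z) (y + a%:C%C *: z) =
  rip y y + 2 * a * rip y z + a ^+ 2 * rip z z.
Proof. by rewrite !(ripDl, ripDr, ripZl, ripZr) (ripC z y); ring. Qed.

Lemma split_bound {R : realType} (s r q1 q2 q3 q4 yy zz yz : R) :
  `|q1| <= s -> `|q2| <= r * zz ->
  `|q3| <= r * (yy + 2 * 4 * yz + 4 ^+ 2 * zz) ->
  `|q4| <= r * (yy + 2 * (- 4) * yz + (- 4) ^+ 2 * zz) ->
  r * yy <= r -> r * zz <= r * (1 / 16) ->
  `|q1 + q2 + (q3 - q4) / 8| <= s + 9 / 16 * r.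
Proof.
move=> h1 h2 h3 h4 h5 h6.
apply: le_trans (ler_normD _ _) _.
have := ler_normD q1 q2.
rewrite normrM (ger0_norm (_ : 0 <= 8^-1)) ?invr_ge0//.
have := ler_normB q3 q4.
move: `|_| `|_| `|_| `|_| `|_| `|_| h1 h2 h3 h4 => ? ? ? ? ? ? h1 h2 h3 h4 h7
  h8.
lra.
Qed.

Section NetArgument.
Context {R : realType}.
Local Notation C := R[i].
Variables (n k : nat) (c : 'M[C]_k) (W : 'I_k -> 'M[C]_n).

Let B (x y : 'cV[C]_n) : R := \sum_p \sum_q rip (W p *m x) (c p q *: (W q *m
  y)).
Let Q (x : 'cV[C]_n) : R := gram_form c (fun p => W p *m x).

Let QE x : Q x = B x x.
Proof. by []. Qed.

Let BDl x y z : B (x + y) z = B x z + B y z.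
Proof.
rewrite /B -big_split; apply: eq_bigr => p _; rewrite -big_split.
by apply: eq_bigr => q _; rewrite mulmxDr ripDl.
Qed.

Let BDr x y z : B x (y + z) = B x y + B x z.
Proof.
rewrite /B -big_split; apply: eq_bigr => p _; rewrite -big_split.
by apply: eq_bigr => q _; rewrite mulmxDr scalerDr ripDr.
Qed.

Let BZl (a : R) x y : B (a%:C%C *: x) y = a * B x y.
Proof.
rewrite /B mulr_sumr; apply: eq_bigr => p _; rewrite mulr_sumr.
by apply: eq_bigr => q _; rewrite -scalemxAr ripZl.
Qed.

Let BZr (a : R) x y : B x (a%:C%C *: y) = a * B x y.
Proof.
rewrite /B mulr_sumr; apply: eq_bigr => p _; rewrite mulr_sumr.
by apply: eq_bigr => q _; rewrite -scalemxAr scalerA mulrC -scalerA ripZr.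
Qed.

Hypothesis uW : forall p, W p \is unitarymx.

Let Q_bound x : rip x x <= 1 -> `|Q x| <= \sum_p \sum_q (1 + sqn (c p q)).
Proof.
move=> x1; apply: le_trans (ler_norm_sum _ _ _) _; apply: ler_sum => p _.
apply: le_trans (ler_norm_sum _ _ _) _; apply: ler_sum => q _.
have := rip_CauchySchwarz (W p *m x) (c p q *: (W q *m x)).
rewrite [rip (c p q *: _) _]rip_conjZ scalerA conj_mul_sqn ripZr.
rewrite !rip_unitary//; set t := rip _ _; set r := rip x x in x1 *.
have r0 : 0 <= r := rip_ge0 x.
move=> tr; have tc : t ^+ 2 <= sqn (c p q).
  apply: le_trans tr _; rewrite mulrCA ler_piMr ?sqn_ge0//; nra.
rewrite ler_norml; have := sqr_ge0 (t - 1); have := sqr_ge0 (t + 1).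
have := sqn_ge0 (c p q); move: (sqn _) tc => S; rewrite !expr2 => tc *.
by apply/andP; split; nra.
Qed.

(** For [y] in a net and [z] short, the last three values are only known to be
    bounded by a multiple of the squared length; stretching [z] by [4] before
    polarizing balances the lengths of [y] and [4 z]. *)
Let Q_split y z : Q (y + z) =
  Q y + Q z + (Q (y + 4%:C%C *: z) - Q (y + (- 4)%:C%C *: z)) / 8.
Proof.
rewrite !QE !(BDl, BDr, BZl, BZr).
move: (B y y) (B y z) (B z y) (B z z) => b1 b2 b3 b4; by field.
Qed.

(** The supremum [r] of [|Q|] on the unit ball satisfies
    [r <= s + 9 / 16 r]: split a point of the ball as a point of the net plus a
    remainder of length at most [1 / 4]. *)
Lemma gram_form_net (N : seq 'cV[C]_n) (s : R) :
  (forall y, y \in N -> rip y y <= 1) ->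
  (forall x, rip x x <= 1 ->
     exists2 y, y \in N & rip (x - y) (x - y) <= 1 / 16) ->
  (forall y, y \in N -> `|gram_form c (fun p => W p *m y)| <= s) ->
  forall x, rip x x <= 1 -> `|gram_form c (fun p => W p *m x)| <= 3 * s.
Proof.
move=> N1 Nx Ns.
pose S : set R := [set `|Q x| | x in [set x | rip x x <= 1]].
have S0 : S !=set0 by exists `|Q 0|, 0 => //=; rewrite rip0l.
have Sub : has_ubound S.
  by exists (\sum_p \sum_q (1 + sqn (c p q))) => _ [x x1 <-]; exact: Q_bound.
pose r := sup S.
have rP x : rip x x <= 1 -> `|Q x| <= r.
  by move=> x1; apply: ub_le_sup => //; exists x.
have r0 : 0 <= r by apply: le_trans (rP 0 _); rewrite ?rip0l.
have rQ x : `|Q x| <= r * rip x x.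
  have [x0|x0] := eqVneq (rip x x) 0.
    rewrite x0 (rip_eq0 x0) mulr0 QE.
    have := BZl 0 0 0; rewrite scaler0 mul0r => ->; by rewrite normr0.
  have x1 : 0 < rip x x by rewrite lt_def x0 rip_ge0.
  pose a := (Num.sqrt (rip x x))^-1.
  have a2 : a * a = (rip x x)^-1 by rewrite -expr2 exprVn sqr_sqrtr// ltW.
  have := rP (a%:C%C *: x); rewrite ripZl ripZr mulrA a2 mulVf// lexx => /(_
    isT).
  rewrite QE BZl BZr mulrA a2 normrM.
  have ri : 0 <= (rip x x)^-1 by rewrite invr_ge0 ltW.
  by rewrite (ger0_norm ri) ler_pdivrMl// mulrC.
suff rs : r <= 3 * s by move=> x x1; exact: le_trans (rP x x1) rs.
suff : r <= s + 9 / 16 * r by have := r0; lra.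
apply: ge_sup => // _ [x x1 <-].
have [y yN xy] := Nx x x1; set z := x - y in xy.
have -> : x = y + z by rewrite /z addrC subrK.
rewrite Q_split.
have Qy : `|Q y| <= s := Ns y yN.
have Qz := rQ z.
have Qp := rQ (y + 4%:C%C *: z).
have Qm := rQ (y + (- 4)%:C%C *: z).
rewrite !rip_add_scale in Qp Qm.
have h1 : r * rip y y <= r by rewrite ler_piMr// N1.
have h2 : r * rip z z <= r * (1 / 16) by rewrite ler_wpM2l.
exact: split_bound Qy Qz Qp Qm h1 h2.
Qed.

End NetArgument.

(** * The off-diagonal Gram matrix *)

Section GramOffDiagonal.
Context {R : realType}.
Local Notation C := R[i].

(** The factor [1 / 32] brings the unit ball into the range of [gram_mgf]. *)
Definition offdiag k (c : 'M[C]_k) : 'M[C]_k :=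
  \matrix_(p, q) if p == q then 0 else (1 / 32)%:C%C * c p q.

Lemma offdiag_diag k (c : 'M[C]_k) p : offdiag c p p = 0.
Proof. by rewrite mxE eqxx. Qed.

Lemma hs_offdiag k (c : 'M[C]_k) : hs c <= 1 -> hs (offdiag c) <= (1 / 32) ^+ 2.
Proof.
move=> c1; apply: le_trans (_ : (1 / 32) ^+ 2 * hs c <= _); last first.
  by rewrite ler_piMr// exprn_ge0// divr_ge0.
rewrite !hsE mulr_sumr; apply: ler_sum => p _; rewrite mulr_sumr.
apply: ler_sum => q _; rewrite mxE; case: eqP => _.
  by rewrite sqn0 mulr_ge0 ?sqn_ge0// exprn_ge0// divr_ge0.
by rewrite sqnM {1}/sqn /= expr0n addr0.
Qed.

Definition inner n (u v : 'cV[C]_n) : C := (u ^t* *m v) 0 0.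

(** Conjugated so that pairing it with [c] by the Hilbert-Schmidt inner product
    gives the off-diagonal part of the Gram form of [c]. *)
Definition gram_offdiag n k (u : 'I_k -> 'cV[C]_n) : 'M[C]_k :=
  \matrix_(p, q) if p == q then 0 else Num.conj (inner (u p) (u q)).

Lemma gram_form_offdiag n k (c : 'M[C]_k) (u : 'I_k -> 'cV[C]_n) :
  gram_form (offdiag c) u =
  1 / 32 * rip (mxvec c)^T (mxvec (gram_offdiag u))^T.
Proof.
rewrite rip_mxvec mulr_sumr; apply: eq_bigr => p _; rewrite mulr_sumr.
apply: eq_bigr => q _; rewrite !mxE; case: eqP => _.
  by rewrite scale0r rip0r /= !mulr0 addr0 mulr0.
rewrite /rip -scalemxAr mxE -/(inner _ _) !complexReM !complexImM.
by rewrite complexRe_conj complexIm_conj /=; ring.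
Qed.

(** By duality: a net point [c] within [1 / 4] of the normalised Gram matrix
    pairs with it to at least [15 / 32] of its norm [e], so that
    [15 / 32 * e / 32 <= 3 s]. *)
Lemma hs_gram_offdiag_le n k (W : 'I_k -> 'M[C]_n) (Nx : seq 'cV[C]_n)
    (Nc : seq 'M[C]_k) (s : R) :
  0 <= s -> (forall p, W p \is unitarymx) ->
  (forall y, y \in Nx -> rip y y <= 1) ->
  (forall x, rip x x <= 1 ->
     exists2 y, y \in Nx & rip (x - y) (x - y) <= 1 / 16) ->
  (forall c, hs c <= 1 -> exists2 c', c' \in Nc & hs (c - c') <= 1 / 16) ->
  (forall c y, c \in Nc -> y \in Nx ->
     `|gram_form (offdiag c) (fun p => W p *m y)| <= s) ->
  forall x, rip x x <= 1 -> hs (gram_offdiag (fun p => W p *m x)) <= (205 * s)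
    ^+ 2.
Proof.
move=> s0 uW N1 NP NcP small x x1.
set E := gram_offdiag _.
have [E0|E0] := eqVneq (hs E) 0; first by rewrite E0 sqr_ge0.
have hE : 0 < hs E by rewrite lt_def E0 hs_ge0.
pose e := Num.sqrt (hs E).
have e0 : 0 < e by rewrite sqrtr_gt0.
have ee : e ^+ 2 = hs E by rewrite sqr_sqrtr// ltW.
have [|c cN] := NcP ((e^-1)%:C%C *: E).
  rewrite /hs !linearZ /= ripZl ripZr -/(hs E) -ee mulrA -invfM -expr2 mulVf//.
  by rewrite expf_neq0// gt_eqF.
rewrite /hs !linearB !linearZ /= !(ripDl, ripDr, ripNl, ripNr, ripZl, ripZr).
rewrite -/(hs E) -ee (_ : e^-1 * (e^-1 * e ^+ 2) = 1); last first.
  by field; rewrite gt_eqF.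
rewrite (ripC (mxvec E)^T).
have := gram_form_net uW N1 NP (fun y => small c y cN) x1.
rewrite gram_form_offdiag -/E ler_norml => /andP[_].
have := rip_ge0 (mxvec c)^T.
set X := rip (mxvec c)^T (mxvec E)^T; set Y := rip _ _ => Y0 Xs XY.
have {}XY : 15 / 32 * e <= X.
  rewrite -ler_pdivlMr// mulrC; move: (e^-1) X Y Y0 XY {Xs} => i X Y; lra.
rewrite ler_pXn2r ?nnegrE ?(ltW e0) ?mulr_ge0//.
move: e X Xs XY {e0 ee Y0} => e X; lra.
Qed.

Lemma hs_gram_offdiagE n k (u : 'I_k -> 'cV[C]_n) :
  hs (gram_offdiag u) = \sum_p \sum_(q | q != p) sqn (inner (u p) (u q)).
Proof.
rewrite hsE; apply: eq_bigr => p _; rewrite (bigD1 p)//= mxE eqxx sqn0 add0r.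
by apply: eq_bigr => q qp; rewrite mxE eq_sym (negbTE qp) sqn_conj.
Qed.

End GramOffDiagonal.

(** * The almost sure uniform bound *)

Section UniformGramBound.
Context {R : realType} {d : measure_display} {T : measurableType d}.
Context (P : probability T R).
Local Notation C := R[i].

(** The Borel-Cantelli lemma for a geometric series. *)
Lemma ae_eventually_not (B : nat -> set T) (e : R) : 0 <= e ->
  (forall n, measurable (B n)) ->
  (forall n, (P (B n) <= (e / (2 ^ n.+1)%:R)%:E)%E) ->
  {ae P, forall w, exists n0 : nat, forall n : nat, (n0 <= n)%N -> ~ B n w}.
Proof.
move=> e0 mB PB; exists (lim_sup_set B); split.
- apply: bigcapT_measurable => n; exact: bigcup_measurable.
- apply: lim_sup_set_cvg0 => //.
  apply: le_lt_trans (ltry e); apply: le_trans (epsilon_trick0 predT e0).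
  by apply: lee_nneseries => [n _ _|n _]; [exact: measure_ge0|exact: PB].
move=> w /= Bw n _; apply: contrapT => nB; apply: Bw.
by exists n => m nm Bm; apply: nB; exists m.
Qed.

Lemma measure_bigsetU_le (I : eqType) (r : seq I) (A : I -> set T) (b : R) :
  (forall i, measurable (A i)) -> (forall i, i \in r -> (P (A i) <= b%:E)%E) ->
  (P (\big[setU/set0]_(i <- r) A i) <= ((size r)%:R * b)%:E)%E.
Proof.
move=> mA; elim: r => [_|i r IH Ab]; first by rewrite big_nil measure0 mul0r.
rewrite big_cons; apply: le_trans (measureU2 _ (mA i) _) _.
  exact: bigsetU_measurable.
rewrite /= -nat1r mulrDl mul1r EFinD; apply: leeD.
  by apply: Ab; rewrite mem_head.
by apply: IH => j jr; apply: Ab; rewrite inE jr orbT.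
Qed.

(** The threshold [s = 1 + 37 ln 2] gives every bad event probability at most
    [2 ^ (- 37 n)], against the [2 ^ (36 n)] points of the net.  Bounds on both
    signs of the Gram form come from adding the opposites to the net of
    coefficients. *)
Lemma haar_gram_bound k (U : forall n : nat, 'I_k -> T -> 'M[C]_n) :
  (forall n : nat, (1 <= n)%N ->
     (forall i : 'I_k, haar_unitary P (U n i)) /\
     mutually_independent P (U n)) ->
  {ae P, forall w : T, exists n0 : nat, forall n : nat, (n0 <= n)%N ->
     forall x : 'cV[C]_n, rip x x <= 1 ->
       hs (gram_offdiag (fun p => U n p w *m x)) <=
         (205 * (1 + 37 * ln 2)) ^+ 2}.
Proof.
move=> hU; pose s : R := 1 + 37 * ln 2.
have s0 : 0 <= s by rewrite addr_ge0// mulr_ge0// ln_ge0// ler1n.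
have [Nc [Nc1 NcP]] := @hs_ball_net R k.
have [Nx NxP] : exists Nx : forall n, seq 'cV[C]_n, forall n,
    (size (Nx n) <= 2 ^ (36 * n))%N /\
    (forall y, y \in Nx n -> rip y y <= 1) /\
    (forall x, rip x x <= 1 ->
       exists2 y, y \in Nx n & rip (x - y) (x - y) <= 1 / 16).
  have h n : exists N : seq 'cV[C]_n, (size N <= 2 ^ (36 * n))%N /\
    (forall y, y \in N -> rip y y <= 1) /\
    (forall x, rip x x <= 1 ->
       exists2 y, y \in N & rip (x - y) (x - y) <= 1 / 16).
    by have [N] := @complex_ball_net R n; exists N.
  exists (fun n => sval (cid (h n))) => n.
  exact: svalP (cid (h n)).
pose r n := [seq (c, y) | c <- Nc ++ [seq - c | c <- Nc], y <- Nx n].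
pose E n (cy : 'M[C]_k * 'cV[C]_n) : set T :=
  [set w | s <= gram_form (offdiag cy.1) (fun p => U n p w *m cy.2)].
pose B n : set T :=
  (* Matrices of size 0 are left unconstrained. *)
  if n is 0%N then set0 else \big[setU/set0]_(cy <- r n) E n cy.
have mE n cy : (0 < n)%N -> measurable (E n cy).
  move=> n0; have [hUn _] := hU n n0.
  have := measurable_gram_form cy.2 hUn (offdiag cy.1).
  move=> /(_ measurableT `[s, +oo[%classic (measurable_itv _)).
  rewrite setTI; congr measurable; apply/seteqP; split => w /=;
    by rewrite in_itv /= andbT.
have PE n cy : (0 < n)%N -> cy \in r n -> (P (E n cy) <= ((2 ^ (37 *
  n))%:R^-1)%:E)%E.
  move=> n0 /allpairsP[[c y] /= [cN yN ->]]; have [hUn iU] := hU n n0.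
  have c1 : hs c <= 1.
    move: cN; rewrite mem_cat => /orP[/Nc1//|/mapP[c' /Nc1 c1 ->]].
    by rewrite /hs !linearN /= ripNl ripNr opprK.
  have [_ [Nx1 _]] := NxP n.
  have := gram_tail hUn iU n0 (Nx1 y yN) s (offdiag_diag c) (hs_offdiag c1).
  move=> /le_trans; apply; rewrite lee_fin.
  have -> : n%:R * (1 - s) = - ((37 * n)%:R * ln 2).
    by rewrite /s natrM; ring.
  by rewrite expRN natrX expRM_natl lnK// posrE.
have mB n : measurable (B n).
  by case: n => [|n] //=; apply: bigsetU_measurable => cy _; exact: mE.
pose e : R := 4 * (size Nc)%:R.
have PB n : (P (B n) <= (e / (2 ^ n.+1)%:R)%:E)%E.
  case: n => [|n] /=; first by rewrite measure0 lee_fin divr_ge0// mulr_ge0.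
  apply: le_trans (measure_bigsetU_le (fun cy => mE n.+1 cy isT)
                                      (fun cy => PE n.+1 cy isT)) _.
  set m := n.+1; have [sN _] := NxP m.
  have sr : (size (r m) <= 2 * size Nc * 2 ^ (36 * m))%N.
    by rewrite size_allpairs size_cat size_map addnn -mul2n leq_mul2l sN orbT.
  rewrite lee_fin ler_pdivrMr ?ltr0n ?expn_gt0//.
  apply: le_trans (_ : (2 * size Nc * 2 ^ (36 * m))%:R <= _).
    by rewrite ler_nat.
  have -> : (37 * m = 36 * m + m)%N by rewrite mulSnr.
  rewrite /e expnD expnS !natrM; have : 0 < (2 ^ m)%:R :> R by rewrite ltr0n
    expn_gt0.
  move: ((2 ^ m)%:R) ((2 ^ (36 * m))%:R) => a b a0.
  by rewrite le_eqVlt; apply/orP; left; apply/eqP; field; rewrite gt_eqF.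
have e0 : 0 <= e by rewrite mulr_ge0.
apply: filterS (ae_eventually_not e0 mB PB) => w [n0 Bw].
exists n0.+1 => -[//|n] nn x x1.
have {}Bw : ~ B n.+1 w by apply: Bw; exact: ltnW.
have [_ [Nx1 NxP1]] := NxP n.+1; have [hUn _] := hU n.+1 isT.
apply: (hs_gram_offdiag_le s0 _ Nx1 NxP1 NcP _ x1) => [p|c y cN yN].
  exact: haar_unitarymx (hUn p) w.
have notE c' : c' \in Nc ++ [seq - c | c <- Nc] ->
    gram_form (offdiag c') (fun p => U n.+1 p w *m y) <= s.
  move=> cN'; rewrite leNgt; apply/negP => /ltW sE; apply: Bw => /=.
  by rewrite -bigcup_seq; exists (c', y) => //=; exact: allpairs_f.
rewrite ler_norml notE ?mem_cat ?cN// andbT.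
have := notE (- c); rewrite mem_cat map_f ?orbT// => /(_ isT).
by rewrite !gram_form_offdiag !linearN /= ripNl mulrN lerNl.
Qed.

End UniformGramBound.

(** * Spectral decomposition of Hermitian matrices *)

Section Spectrum.
Context {R : realType}.
Local Notation C := R[i].

Lemma hermsymmxP n (X : 'M[C]_n) : X \is hermsymmx <-> X ^t* = X.
Proof.
split=> [/is_hermitianmxP|XE]; rewrite ?expr0 ?scale1r; first by move=> {2}->.
by apply/is_hermitianmxP; rewrite expr0 scale1r.
Qed.

Lemma trmxC_mul m n p (A : 'M[C]_(m, n)) (B : 'M[C]_(n, p)) :
  (A *m B) ^t* = B ^t* *m A ^t*.
Proof. by rewrite trmx_mul map_mxM. Qed.

Lemma rip_mxvec_trace m n (A B : 'M[C]_(m, n)) :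
  rip (mxvec A)^T (mxvec B)^T = complex.Re (\tr (A ^t* *m B)).
Proof.
rewrite rip_mxvec exchange_big /mxtrace complexRe_sum /=; apply: eq_bigr => q _.
rewrite mxE complexRe_sum; apply: eq_bigr => p _; rewrite !mxE complexReM.
by rewrite complexRe_conj complexIm_conj mulNr opprK.
Qed.

Definition eigval n (X : 'M[C]_n) (a : 'I_n) : R :=
  complex.Re (spectral_diag X 0 a).

(** Rows of [spectralmx X] are adjoints of the eigenvectors. *)
Definition eigvec n (X : 'M[C]_n) (a : 'I_n) : 'cV[C]_n :=
  (row a (spectralmx X)) ^t*.

Lemma eigvec_orthonormal n (X : 'M[C]_n) a b :
  (eigvec X a) ^t* *m eigvec X b = ((a == b)%:R)%:M.
Proof.
rewrite /eigvec trmxCK.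
have /unitarymxP/matrixP/(_ a b) := spectral_unitarymx X.
rewrite !mxE => SS; apply/matrixP => i j; rewrite !ord1 !mxE eqxx mulr1n -SS.
by apply: eq_bigr => l _; rewrite !mxE.
Qed.

Lemma rip_eigvec n (X : 'M[C]_n) a : rip (eigvec X a) (eigvec X a) = 1.
Proof. by rewrite /rip eigvec_orthonormal !mxE !eqxx mulr1n. Qed.

Lemma eigvec_complete n (X : 'M[C]_n) :
  \sum_a eigvec X a *m (eigvec X a) ^t* = 1%:M.
Proof.
rewrite -(unitarymxV (spectral_unitarymx X)).
apply/matrixP => i j; rewrite summxE mxE; apply: eq_bigr => a _.
by rewrite /eigvec trmxCK !mxE big_ord1 !mxE.
Qed.

Variables (n : nat) (X : 'M[C]_n).
Hypothesis Xh : X \is hermsymmx.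

Lemma spectral_diagE a : spectral_diag X 0 a = (eigval X a)%:C%C.
Proof.
have /mxOverP/(_ 0 a)/complex_realP[r Er] := hermitian_spectral_diag_real Xh.
by rewrite /eigval Er.
Qed.

Lemma spectral_sum :
  X = \sum_a (eigval X a)%:C%C *: (eigvec X a *m (eigvec X a) ^t*).
Proof.
have /orthomx_spectralP {1}-> := hermitian_normalmx Xh.
rewrite invmx_unitary ?spectral_unitarymx//.
apply/matrixP => i j; rewrite summxE mxE; apply: eq_bigr => a _.
rewrite /eigvec trmxCK mxE (bigD1 a)//= big1 ?addr0; last first.
  by move=> b ba; rewrite [diag_mx _ _ _]mxE (negbTE ba) mulr0n mulr0.
rewrite [diag_mx _ _ _]mxE eqxx mulr1n spectral_diagE !mxE big_ord1 !mxE.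
by rewrite mulrAC mulrC mulrA.
Qed.

Lemma mul_eigvec a : X *m eigvec X a = (eigval X a)%:C%C *: eigvec X a.
Proof.
rewrite {1}spectral_sum mulmx_suml (bigD1 a)//= big1 ?addr0 => [|b ba].
  by rewrite -scalemxAl -mulmxA eigvec_orthonormal eqxx mulmx1.
by rewrite -scalemxAl -mulmxA eigvec_orthonormal (negbTE ba) mul_mx_scalar
  scale0r scaler0.
Qed.

Lemma entropyE : entropy X = - \sum_a eigval X a * ln (eigval X a).
Proof.
rewrite /entropy /hermfun.
have /orthomx_spectralP XE := hermitian_normalmx Xh.
rewrite {1}XE !mulmxA mulmxK ?spectral_unit// mxtrace_mulC !mulmxA.
rewrite mulmxV ?spectral_unit// mul1mx mul_diag_mx /mxtrace complexRe_sum.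
congr (- _); apply: eq_bigr => a _; rewrite !mxE eqxx mulr1n.
by rewrite spectral_diagE complexReM /= mul0r subr0.
Qed.

Lemma sum_eigval : \sum_a eigval X a = complex.Re (\tr X).
Proof.
have /orthomx_spectralP XE := hermitian_normalmx Xh.
rewrite {2}XE -mulmxA mxtrace_mulC mulmxK ?spectral_unit// mxtrace_diag.
by rewrite complexRe_sum.
Qed.

Lemma sum_eigval_sqr : \sum_a eigval X a ^+ 2 = hs X.
Proof.
have /orthomx_spectralP XE := hermitian_normalmx Xh.
rewrite /hs rip_mxvec_trace (hermsymmxP X).1//.
have -> : \tr (X *m X) = \tr (diag_mx (spectral_diag X) *m diag_mx
  (spectral_diag X)).
  move: (spectral_unit X) XE; move: (spectralmx X) (diag_mx _) => S D uS ->.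
  by rewrite !mulmxA mulmxK// mxtrace_mulC !mulmxA mulmxV// mul1mx.
rewrite mul_diag_mx /mxtrace complexRe_sum; apply: eq_bigr => a _.
by rewrite !mxE eqxx mulr1n spectral_diagE complexReM /= mul0r subr0 expr2.
Qed.

(** Compressing the diagonal form to the nonzero eigenvalues leaves an
    invertible matrix. *)
Lemma card_eigval_neq0 : (#|[set a | eigval X a != 0%R]%SET| <= \rank X)%N.
Proof.
set A := [set a | _]%SET.
have /orthomx_spectralP XE := hermitian_normalmx Xh.
have rX : \rank X = \rank (diag_mx (spectral_diag X)).
  move: (spectral_unit X) XE; move: (spectralmx X) (diag_mx _) => S D uS ->.
  by rewrite mxrankMfree ?row_free_unit// eqmxMfull// row_full_unit unitmx_inv.
rewrite rX.
pose f (i : 'I_#|A|) : 'I_n := enum_val i.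
pose M : 'M[C]_(#|A|, n) := \matrix_(i, j) (f i == j)%:R.
pose D := diag_mx (spectral_diag X).
have -> : #|A| = \rank (M *m D *m M^T).
  apply/esym/mxrank_unit.
  have -> : M *m D *m M^T = diag_mx (\row_i spectral_diag X 0 (f i)).
    apply/matrixP => i j; rewrite mul_mx_diag !mxE (bigD1 (f j))//= big1 => [|l
      lj].
      rewrite !mxE eqxx mulr1 addr0 (inj_eq enum_val_inj).
      by case: eqP => [->|_]; rewrite ?mulr1n ?mul1r// mul0r mulr0n.
    by rewrite !mxE [f j == l]eq_sym (negbTE lj) mulr0.
  rewrite unitmxE det_diag unitfE; apply/prodf_neq0 => i _.
  rewrite mxE spectral_diagE; have := enum_valP i; rewrite inE -/(f i).
  by apply: contraNneq => /complexI ->.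
exact: leq_trans (mxrankM_maxl _ _) (mxrankM_maxr _ _).
Qed.

End Spectrum.

(** * Entropy bounds *)

Section EntropyBounds.
Context {R : realType}.
Local Notation C := R[i].

Lemma rip_mulmx_real n (X : 'M[C]_n) (v : 'cV[C]_n) :
  rip v (X *m v) = complex.Re ((v ^t* *m X *m v) 0 0).
Proof. by rewrite /rip mulmxA. Qed.

Lemma psd_rip_ge0 n (X : 'M[C]_n) (v : 'cV[C]_n) :
  psdmx X -> 0 <= rip v (X *m v).
Proof.
by move=> [_ /(_ v)]; rewrite rip_mulmx_real lecE /= => /andP[].
Qed.

Lemma eigval_ge0 n (X : 'M[C]_n) a : psdmx X -> 0 <= eigval X a.
Proof.
move=> Xpsd; have := psd_rip_ge0 (eigvec X a) Xpsd.
by rewrite (mul_eigvec Xpsd.1) ripZr rip_eigvec mulr1.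
Qed.

Lemma psdmx_mul m n (A : 'M[C]_(m, n)) (X : 'M[C]_n) :
  psdmx X -> psdmx (A *m X *m A ^t*).
Proof.
move=> [Xh Xp]; split.
  by apply/hermsymmxP; rewrite !trmxC_mul trmxCK (hermsymmxP X).1// mulmxA.
move=> v; have := Xp (A ^t* *m v).
by rewrite trmxC_mul trmxCK !mulmxA.
Qed.

Lemma psdmx_sum n (I : Type) (r : seq I) (p : pred I) (F : I -> 'M[C]_n) :
  (forall i, psdmx (F i)) -> psdmx (\sum_(i <- r | p i) F i).
Proof.
move=> Fp; elim/big_ind: _ => [|A B [Ah Ap] [Bh Bp]|i _]; last exact: Fp.
  split=> [|v]; last by rewrite mulmx0 mul0mx mxE.
  by apply/hermsymmxP; rewrite trmx0 map_mx0.
split=> [|v]; last by rewrite mulmxDr mulmxDl mxE addr_ge0.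
apply/hermsymmxP; rewrite linearD /= map_mxD.
by rewrite (hermsymmxP A).1// (hermsymmxP B).1.
Qed.

Lemma psdmx_scale n (a : C) (X : 'M[C]_n) : 0 <= a -> psdmx X -> psdmx (a *: X).
Proof.
move=> a0 [Xh Xp]; split=> [|v].
  apply/hermsymmxP; rewrite linearZ /= map_mxZ (hermsymmxP X).1//.
  by rewrite /= geC0_conj.
by rewrite -scalemxAr -scalemxAl mxE mulr_ge0.
Qed.

Lemma psdmx_proj n (x : 'cV[C]_n) : psdmx (x *m x ^t*).
Proof.
rewrite -[x *m _]/(x *m x ^t*) -[X in X *m _]mulmx1; apply: psdmx_mul.
split=> [|v]; first by apply/hermsymmxP; rewrite trmx1 map_mx1.
rewrite mulmx1 mxE sumr_ge0// => i _.
by rewrite !mxE mulrC -normCK exprn_ge0.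
Qed.

Lemma density_proj n (x : 'cV[C]_n) : rip x x = 1 -> density (x *m x ^t*).
Proof.
move=> x1; split; first exact: psdmx_proj.
rewrite mxtrace_mulC /mxtrace big_ord1.
have xx0 : 0 <= (x ^t* *m x) 0 0.
  by rewrite mxE sumr_ge0// => i _; rewrite !mxE mulrC -normCK exprn_ge0.
apply/eqP; rewrite eq_complex -[complex.Re _]/(rip x x) x1 eqxx /=.
by apply/eqP; exact: ger0_Im.
Qed.

Lemma sum_eigval_density n (X : 'M[C]_n) :
  density X -> \sum_a eigval X a = 1.
Proof. by move=> [[Xh _] trX]; rewrite sum_eigval// trX. Qed.

(** This is [ln y <= y - 1] at [y = t / x]. *)
Lemma gibbs (x t : R) : 0 < x -> 0 < t ->
  - (x * ln x) <= - (x * ln t) + (t - x).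
Proof.
move=> x0 t0; have tx0 : 0 < t / x by rewrite divr_gt0.
have := @le_ln1Dx R (t / x - 1); rewrite addrCA subrr addr0.
rewrite ltrBDr addNr => /(_ tx0); rewrite ln_div ?posrE// => h.
have := ler_wpM2l (ltW x0) h; rewrite !mulrBr mulr1 mulrCA divff ?gt_eqF//
  mulr1.
lra.
Qed.

(** Concavity of the logarithm, through its tangent at [q], averaged over the
    spectrum. *)
Lemma entropy_ge_purity n (X : 'M[C]_n) (q : R) :
  density X -> 0 < q -> hs X <= q -> - ln q <= entropy X.
Proof.
move=> Xd q0 Xq; have [[Xh _] _] := Xd.
rewrite entropyE// lerN2.
apply: le_trans (_ : \sum_a (eigval X a * ln q + (eigval X a ^+ 2 / q - eigval
  X a)) <= _).
  apply: ler_sum => a _; have := eigval_ge0 a Xd.1.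
  rewrite le_eqVlt => /predU1P[<-|l0].
    by rewrite !mul0r expr0n mul0r subr0 addr0.
  have lq : 0 <= eigval X a / q by rewrite divr_ge0// ltW.
  have := ler_wpM2l lq (gibbs q0 l0).
  move: (eigval X a) (ln _) (ln _) => l ll lnq.
  have -> : l / q * - (q * lnq) = - (l * lnq) by field; rewrite gt_eqF.
  have -> : l / q * (- (q * ll) + (l - q)) = - (l * ll) + (l ^+ 2 / q - l).
    by field; rewrite gt_eqF.
  lra.
rewrite big_split /= -mulr_suml sum_eigval_density// mul1r sumrB -mulr_suml.
rewrite sum_eigval_density// sum_eigval_sqr//.
by rewrite gerDl subr_le0 ler_pdivrMr// mul1r.
Qed.

Lemma hs_density_le1 n (X : 'M[C]_n) : density X -> hs X <= 1.
Proof.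
move=> Xd; have [[Xh _] _] := Xd.
rewrite -sum_eigval_sqr// -(sum_eigval_density Xd).
apply: ler_sum => a _; rewrite expr2 ler_piMr ?eigval_ge0//; first exact: Xd.1.
rewrite -(sum_eigval_density Xd) (bigD1 a)//= lerDl sumr_ge0// => b _.
exact: (eigval_ge0 b Xd.1).
Qed.

Lemma entropy_ge0 n (X : 'M[C]_n) : density X -> 0 <= entropy X.
Proof.
by move=> Xd; rewrite -oppr0 -ln1; apply: entropy_ge_purity (hs_density_le1 Xd).
Qed.

(** The left-hand side is an average of the eigenvalues with weights
    [|<eigvec X a, b>| ^ 2]. *)
Lemma exists_eigval_ge n (X : 'M[C]_n) (b : 'cV[C]_n) :
  X \is hermsymmx -> rip b b = 1 -> exists a, rip b (X *m b) <= eigval X a.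
Proof.
move=> Xh b1.
pose w a : R := rip b (eigvec X a *m (eigvec X a) ^t* *m b).
have w0 a : 0 <= w a by exact: psd_rip_ge0 (psdmx_proj _).
have w1 : \sum_a w a = 1.
  rewrite /w -rip_sumr -mulmx_suml.
  by under eq_bigr do [];
    rewrite eigvec_complete mul1mx.
have XbE : rip b (X *m b) = \sum_a eigval X a * w a.
  rewrite {1}(spectral_sum Xh) mulmx_suml rip_sumr; apply: eq_bigr => a _.
  by rewrite -scalemxAl ripZr.
case: (posnP n) => [n0|n0].
  move: b1; rewrite ripE big1 => [/esym/eqP|i _]; first by rewrite oner_eq0.
  by have := leq_trans (ltn_ord i) (eq_leq n0).
pose a0 := [arg max_(a > Ordinal n0) eigval X a]%O.
exists a0; rewrite XbE -[leRHS]mulr1 -w1 mulr_sumr; apply: ler_sum => a _.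
apply: ler_wpM2r => //; rewrite /a0; case: arg_maxP => // i _; exact.
Qed.

(** Gibbs' inequality against the weight [1 / k] on a large eigenvalue and
    [1 / k ^ 2] on the other nonzero ones, whose total mass is at most
    [1 + 1 / k]. *)
Lemma entropy_le_rank n (X : 'M[C]_n) (k : nat) (b : 'cV[C]_n) :
  (0 < k)%N -> density X -> (\rank X <= k ^ 2)%N -> rip b b = 1 ->
  k%:R^-1 <= rip b (X *m b) ->
  entropy X <= 2 * ln k%:R - ln k%:R / k%:R + k%:R^-1.
Proof.
move=> k0 Xd rX b1 bX; have [Xpsd _] := Xd; have [Xh _] := Xpsd.
have [a0 Xa0] := exists_eigval_ge Xh b1.
have kR : 0 < k%:R :> R by rewrite ltr0n.
have l0 : k%:R^-1 <= eigval X a0 by exact: le_trans Xa0.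
have l0' : 0 < eigval X a0 by apply: lt_le_trans l0; rewrite invr_gt0.
pose t (a : 'I_n) : R := if a == a0 then k%:R^-1 else k%:R^-1 ^+ 2.
have t0 a : 0 < t a by rewrite /t; case: ifP => _; rewrite ?exprn_gt0 ?invr_gt0.
pose A := [set a | eigval X a != 0]%SET.
have suppE (f : 'I_n -> R) : (forall a, eigval X a = 0 -> f a = 0) ->
    \sum_a f a = \sum_(a in A) f a.
  move=> f0; rewrite (bigID [in A])/= [X in _ + X]big1 ?addr0// => a.
  by rewrite inE negbK => /eqP /f0.
rewrite entropyE// -sumrN.
rewrite suppE => [|a ->]; last by rewrite mul0r oppr0.
apply: le_trans (_ : \sum_(a in A) (- (eigval X a * ln (t a)) +
                                    (t a - eigval X a)) <= _).
  apply: ler_sum => a; rewrite inE => la; apply: gibbs => //.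
  by rewrite lt_def la eigval_ge0.
rewrite big_split /= sumrB -[\sum_(a in A) eigval X a]suppE//
  sum_eigval_density//.
rewrite -[X in X + _]suppE => [|a ->]; last by rewrite mul0r oppr0.
have a0A : a0 \in A by rewrite inE gt_eqF.
have tA : \sum_(a in A) t a <= k%:R^-1 + 1.
  rewrite (bigD1 a0)//= {1}/t eqxx lerD2l.
  apply: le_trans (_ : \sum_(a in A) k%:R^-1 ^+ 2 <= _).
    rewrite [leRHS](bigD1 a0)//= -[leLHS]add0r lerD ?exprn_ge0 ?invr_ge0//.
    by apply: ler_sum => a /andP[_ aa0]; rewrite /t (negbTE aa0).
  rewrite sumr_const -[_ *+ #|_|]mulr_natr exprVn ler_pdivrMl ?exprn_gt0//
    mulr1.
  by rewrite -natrX ler_nat (leq_trans _ rX)// card_eigval_neq0.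
have lnk : 0 <= ln k%:R :> R by rewrite ln_ge0// ler1n.
have main : \sum_a - (eigval X a * ln (t a)) <= 2 * ln k%:R - ln k%:R / k%:R.
  rewrite (bigD1 a0)//= {1}/t eqxx lnV ?posrE//.
  have -> : \sum_(a | a != a0) - (eigval X a * ln (t a)) =
            (\sum_(a | a != a0) eigval X a) * (2 * ln k%:R).
    rewrite mulr_suml; apply: eq_bigr => a aa0.
    by rewrite /t (negbTE aa0) lnXn ?invr_gt0// lnV ?posrE// mulNrn mulrN opprK
      mulr_natl.
  have := sum_eigval_density Xd; rewrite (bigD1 a0)//=.
  set S := \sum_(i | _) _; set l := eigval X a0 in l0 *; move=> lS.
  have -> : S = 1 - l by rewrite -lS addrAC subrr add0r.
  have : ln k%:R / k%:R <= ln k%:R * l by rewrite ler_wpM2l.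
  move: (ln k%:R) => L; lra.
by move: main tA; lra.
Qed.

End EntropyBounds.

(** * Outputs of a random unitary channel *)

Section ChannelOutput.
Context {R : realType}.
Local Notation C := R[i].

(** The variance of [y] with respect to the weights [lam] is nonnegative. *)
Lemma rip_convex (I : finType) n (lam : I -> R) (y : I -> 'cV[C]_n) z :
  (forall a, 0 <= lam a) -> \sum_a lam a = 1 ->
  z = \sum_a (lam a)%:C%C *: y a ->
  rip z z <= \sum_a lam a * rip (y a) (y a).
Proof.
move=> lam0 lam1 zE.
have zz : rip z z = \sum_a lam a * rip z (y a).
  by rewrite {2}zE rip_sumr; apply: eq_bigr => a _; rewrite ripZr.
have : 0 <= \sum_a lam a * rip (y a - z) (y a - z).
  by apply: sumr_ge0 => a _; rewrite mulr_ge0// rip_ge0.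
have -> : \sum_a lam a * rip (y a - z) (y a - z) =
    \sum_a lam a * rip (y a) (y a) - 2 * (\sum_a lam a * rip z (y a))
    + (\sum_a lam a) * rip z z.
  rewrite mulr_sumr mulr_suml -sumrB -big_split; apply: eq_bigr => a _ /=.
  rewrite !(ripDl, ripDr, ripNl, ripNr) (ripC (y a) z).
  by move: (rip _ _) (rip _ _) (rip _ _) => b1 b2 b3; ring.
by rewrite lam1 -zz mul1r; move: (rip z z) (\sum_a _) => b1 b2; lra.
Qed.

Section RandomUnitaryChannel.
Variables (k n : nat) (V : 'I_k -> 'M[C]_n).
Hypothesis k_gt0 : (0 < k)%N.

Local Notation Phi := (random_unitary_channel V).

Lemma real_complex_nat (m : nat) : (m%:R : C) = (m%:R : R)%:C%C.
Proof. by rewrite rmorph_nat. Qed.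

Lemma real_complex_natV (m : nat) : (m%:R^-1 : C) = (m%:R^-1 : R)%:C%C.
Proof. by rewrite real_complex_nat fmorphV. Qed.

Lemma density_channel (X : 'M[C]_n) :
  (forall i, V i \is unitarymx) -> density X -> density (Phi X).
Proof.
move=> uV [Xpsd trX]; split.
  apply: psdmx_scale; first by rewrite invr_ge0.
  by apply: psdmx_sum => i; exact: psdmx_mul.
rewrite /random_unitary_channel mxtraceZ raddf_sum /=.
under eq_bigr do rewrite mxtrace_mulC mulmxA unitarymxV// mul1mx trX.
by rewrite sumr_const card_ord mulVf// pnatr_eq0 -lt0n.
Qed.

Lemma innerC (u v : 'cV[C]_n) : inner v u = Num.conj (inner u v).
Proof.
have : (u ^t* *m v) ^t* = v ^t* *m u by rewrite trmxC_mul trmxCK.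
by move/matrixP/(_ 0 0); rewrite /inner => <-; rewrite !mxE.
Qed.

Lemma inner_self (u : 'cV[C]_n) : inner u u = (rip u u)%:C%C.
Proof.
apply/eqP; rewrite eq_complex eqxx /=; apply/eqP/ger0_Im.
by rewrite /inner mxE sumr_ge0// => i _; rewrite !mxE mulrC -normCK exprn_ge0.
Qed.

Lemma rip_mxvec_proj (u v : 'cV[C]_n) :
  rip (mxvec (u *m u ^t*))^T (mxvec (v *m v ^t*))^T = sqn (inner u v).
Proof.
rewrite rip_mxvec_trace trmxC_mul trmxCK mulmxA -(mulmxA u).
rewrite [u ^t* *m v]mx11_scalar -/(inner u v) mul_mx_scalar -scalemxAl mxtraceZ.
by rewrite mxtrace_mulC /mxtrace big_ord1 -/(inner v u) (innerC u v) mulrC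
  conj_mul_sqn.
Qed.

Lemma channel_proj (x : 'cV[C]_n) :
  Phi (x *m x ^t*) =
  (k%:R^-1)%:C%C *: \sum_i (V i *m x) *m (V i *m x) ^t*.
Proof.
rewrite /random_unitary_channel real_complex_natV; congr (_ *: _).
by apply: eq_bigr => i _; rewrite trmxC_mul !mulmxA.
Qed.

Lemma hs_channel_proj (x : 'cV[C]_n) :
  (forall i, V i \is unitarymx) -> rip x x = 1 ->
  hs (Phi (x *m x ^t*)) =
  k%:R^-1 ^+ 2 * (k%:R + hs (gram_offdiag (fun i => V i *m x))).
Proof.
move=> uV x1.
rewrite channel_proj /hs !linearZ /= ripZl ripZr mulrA -expr2; congr (_ * _).
rewrite !linear_sum /= rip_suml -/(hs _) hs_gram_offdiagE.
rewrite -[k in k%:R]card_ord -sum1_card natr_sum -big_split.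
apply: eq_bigr => i _ /=; rewrite rip_sumr (bigD1 i)//=; congr (_ + _).
  by rewrite rip_mxvec_proj inner_self rip_unitary// x1 /sqn /= expr1n expr0n
    addr0.
by apply: eq_bigr => j _; rewrite rip_mxvec_proj.
Qed.

(** By convexity the purity of the output is at most the largest purity that
    an eigenvector of the input gives. *)
Lemma hs_channel_le (S : R) (X : 'M[C]_n) :
  (forall i, V i \is unitarymx) ->
  (forall x, rip x x <= 1 -> hs (gram_offdiag (fun i => V i *m x)) <= S) ->
  density X -> hs (Phi X) <= k%:R^-1 ^+ 2 * (k%:R + S).
Proof.
move=> uV VS Xd; have [[Xh _] _] := Xd.
pose y a : 'cV[C]_(n * n) := (mxvec (Phi (eigvec X a *m (eigvec X a) ^t*)))^T.
pose z : 'cV[C]_(n * n) := (mxvec (Phi X))^T.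
have zE : z = \sum_a (eigval X a)%:C%C *: y a.
  rewrite /z {1}(spectral_sum Xh) !linear_sum /=; apply: eq_bigr => a _.
  have -> : Phi ((eigval X a)%:C%C *: (eigvec X a *m (eigvec X a) ^t*)) =
      (eigval X a)%:C%C *: Phi (eigvec X a *m (eigvec X a) ^t*) by exact: linearZ.
  by rewrite /y; move: (Phi _) => Y; rewrite !linearZ.
set q := _ * _.
have yq a : rip (y a) (y a) <= q.
  rewrite -/(hs _) hs_channel_proj ?rip_eigvec// ler_wpM2l ?exprn_ge0
    ?invr_ge0//.
  by rewrite lerD2l VS// rip_eigvec.
rewrite /hs -/z; apply: le_trans (rip_convex _ _ zE) _.
- by move=> a; exact: (eigval_ge0 _ Xd.1).
- exact: sum_eigval_density.
apply: le_trans (_ : \sum_a eigval X a * q <= _).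
  by apply: ler_sum => a _; rewrite ler_wpM2l// (eigval_ge0 _ Xd.1).
by rewrite -mulr_suml sum_eigval_density// mul1r.
Qed.

(** The purity bound [(k + S) / k ^ 2] has logarithm at most
    [- ln k + S / k]. *)
Lemma min_output_entropy_ge (S : R) :
  (0 < n)%N -> 0 <= S -> (forall i, V i \is unitarymx) ->
  (forall x, rip x x <= 1 -> hs (gram_offdiag (fun i => V i *m x)) <= S) ->
  ln k%:R - S / k%:R <= min_output_entropy Phi.
Proof.
move=> n0 S0 uV VS; have kR : 0 < k%:R :> R by rewrite ltr0n.
apply: lb_le_inf.
  pose e : 'cV[C]_n := delta_mx (Ordinal n0) 0.
  exists (entropy (Phi (e *m e ^t*))), (e *m e ^t*) => //.
  apply: density_proj; rewrite ripE (bigD1 (Ordinal n0))//= big1 => [|i ie].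
    by rewrite !mxE !eqxx /= mulr1 mulr0 !addr0.
  by rewrite !mxE (negbTE ie) /= mulr0 addr0.
move=> _ [X Xd <-].
have Sk : 0 <= S / k%:R by rewrite divr_ge0// ltW.
have q0 : 0 < k%:R^-1 ^+ 2 * (k%:R + S).
  by rewrite mulr_gt0 ?exprn_gt0 ?invr_gt0// ltr_wpDr.
apply: le_trans (entropy_ge_purity (density_channel uV Xd) q0 (hs_channel_le uV
  VS Xd)).
have -> : k%:R^-1 ^+ 2 * (k%:R + S) = k%:R^-1 * (1 + S / k%:R).
  by field; rewrite gt_eqF.
rewrite lnM ?posrE ?invr_gt0 ?ltr_wpDr// lnV ?posrE// opprD opprK lerD2l lerN2.
by apply: le_ln1Dx; rewrite (lt_le_trans _ Sk)// ltrN10.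
Qed.

Lemma rank_channel_proj (x : 'cV[C]_n) : (\rank (Phi (x *m x ^t*)) <= k)%N.
Proof.
rewrite channel_proj; apply: leq_trans (mxrank_scale _ _) _.
rewrite -[leqRHS]card_ord -sum1_card.
elim/big_ind2: _ => [|A a B b Aa Bb|i _]; first by rewrite mxrank0.
  exact: leq_trans (mxrank_add _ _) (leq_add Aa Bb).
by apply: leq_trans (mxrankM_maxl _ _) _; exact: rank_leq_col.
Qed.

End RandomUnitaryChannel.
End ChannelOutput.

(** * The product channel and the maximally entangled vector *)

Section ConjugateChannel.
Context {R : realType}.
Local Notation C := R[i].
Variables (k n : nat) (U : 'I_k -> 'M[C]_n).

(** The conjugate channel is the random unitary channel of the conjugate
    matrices, so both channels are treated alike. *)
Definition conj_family (i : 'I_k) : 'M[C]_n := map_mx Num.conj (U i).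

Lemma conj_random_unitary_channelE :
  conj_random_unitary_channel U = random_unitary_channel conj_family.
Proof.
apply/funext => X; congr (_ *: _); apply: eq_bigr => i _.
by congr (_ *m _); rewrite /conj_family map_trmx -map_mx_comp (map_mx_id
  (@conjCK _)).
Qed.

Lemma conj_family_unitary :
  (forall i, U i \is unitarymx) -> forall i, conj_family i \is unitarymx.
Proof. by move=> uU i; rewrite conjC_unitary. Qed.

Lemma rip_conj (u v : 'cV[C]_n) :
  rip (map_mx Num.conj u) (map_mx Num.conj v) = rip u v.
Proof.
rewrite !ripE; apply: eq_bigr => i _.
by rewrite !mxE !complexRe_conj !complexIm_conj mulrNN.
Qed.

Lemma inner_conj (u v : 'cV[C]_n) :
  inner (map_mx Num.conj u) (map_mx Num.conj v) = Num.conj (inner u v).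
Proof. by rewrite /inner map_trmx -map_mxM [LHS]mxE. Qed.

Lemma conj_family_mul i (x : 'cV[C]_n) :
  conj_family i *m x = map_mx Num.conj (U i *m map_mx Num.conj x).
Proof. by rewrite map_mxM -map_mx_comp (map_mx_id (@conjCK _)). Qed.

Lemma hs_gram_offdiag_conj (x : 'cV[C]_n) :
  hs (gram_offdiag (fun i => conj_family i *m x)) =
  hs (gram_offdiag (fun i => U i *m map_mx Num.conj x)).
Proof.
rewrite !hs_gram_offdiagE; apply: eq_bigr => p _; apply: eq_bigr => q _.
by rewrite !conj_family_mul inner_conj sqn_conj.
Qed.

End ConjugateChannel.

Section TensorChannel.
Context {R : realType}.
Local Notation C := R[i].

Lemma sum_mxtens (V : zmodType) m n (F : 'I_(m * n) -> V) :
  \sum_t F t = \sum_i \sum_j F (mxtens_index (i, j)).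
Proof.
rewrite (reindex (@mxtens_index m n)) /=; last first.
  exact/onW_bij/(Bijective (@mxtens_indexK m n) (@mxtens_unindexK m n)).
by rewrite pair_bigA; apply: eq_bigr => -[].
Qed.

Lemma trmxC_tens m n p q (A : 'M[C]_(m, n)) (B : 'M[C]_(p, q)) :
  (tensmx A B) ^t* = tensmx (A ^t*) (B ^t*).
Proof. by rewrite trmx_tens map_mxT. Qed.

Lemma tens1mx m n : tensmx (1%:M : 'M[C]_m) (1%:M : 'M[C]_n) = 1%:M.
Proof.
apply/matrixP => x y.
case: (mxtens_indexP x) => i j; case: (mxtens_indexP y) => p q.
rewrite tensmxE !mxE -natrM mulnb.
by rewrite (inj_eq (can_inj (@mxtens_indexK m n))) xpair_eqE.
Qed.

Lemma tens_unitary m n (A : 'M[C]_m) (B : 'M[C]_n) :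
  A \is unitarymx -> B \is unitarymx -> tensmx A B \is unitarymx.
Proof.
move=> /unitarymxP uA /unitarymxP uB; apply/unitarymxP.
by rewrite trmxC_tens tensmx_mul uA uB tens1mx.
Qed.

Variables (k n : nat) (U V : 'I_k -> 'M[C]_n).

(** The product channel is itself a random unitary channel, with [k * k]
    unitaries; what is known about outputs applies to it. *)
Definition tens_family (t : 'I_(k * k)) : 'M[C]_(n * n) :=
  tensmx (U (mxtens_unindex t).1) (V (mxtens_unindex t).2).

(** The expansion that underlies the definition of [tens_channel]. *)
Lemma mx_tens_delta (X : 'M[C]_(n * n)) :
  X = \sum_(i < n) \sum_(j < n) \sum_(p < n) \sum_(q < n)
        X (mxtens_index (i, p)) (mxtens_index (j, q))
          *: tensmx (delta_mx i j) (delta_mx p q).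
Proof.
rewrite {1}[X]matrix_sum_delta sum_mxtens.
under eq_bigr do under eq_bigr do rewrite sum_mxtens.
apply: eq_bigr => i _; rewrite exchange_big; apply: eq_bigr => j _.
apply: eq_bigr => p _; apply: eq_bigr => q _; congr (_ *: _).
apply/matrixP => x y.
case: (mxtens_indexP x) => a b; case: (mxtens_indexP y) => c e.
rewrite tensmxE !mxE -natrM mulnb !(inj_eq (can_inj (@mxtens_indexK n n))).
by rewrite !xpair_eqE; congr (_ %:R); case: (a == i); case: (b == p); case: (c
  == j); case: (e == q).
Qed.

Lemma tens_random_unitary_channelE :
  tens_channel (random_unitary_channel U) (random_unitary_channel V) =
  random_unitary_channel tens_family.
Proof.
apply/funext => X; rewrite {2}(mx_tens_delta X) /tens_channel.
rewrite !linear_sum; apply: eq_bigr => i _.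
rewrite !linear_sum; apply: eq_bigr => j _.
rewrite !linear_sum; apply: eq_bigr => p _.
rewrite !linear_sum; apply: eq_bigr => q _.
rewrite linearZ /=; congr (_ *: _).
rewrite /random_unitary_channel natrM invfM.
apply/matrixP => x y; rewrite !mxE !summxE mulrACA; congr (_ * _).
rewrite big_distrlr /= sum_mxtens; apply: eq_bigr => a _; apply: eq_bigr => b _.
rewrite /tens_family mxtens_indexK /= trmxC_tens !tensmx_mul.
by rewrite [RHS]mxE.
Qed.

End TensorChannel.

Section Bell.
Context {R : realType}.
Local Notation C := R[i].
Variable n : nat.
Hypothesis n_gt0 : (0 < n)%N.

(** The maximally entangled unit vector. *)
Definition bell : 'cV[C]_(n * n) :=
  \col_t if (mxtens_unindex t).1 == (mxtens_unindex t).2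
         then (Num.sqrt n%:R^-1)%:C%C else 0.

Lemma rip_bell : rip bell bell = 1.
Proof.
rewrite ripE sum_mxtens.
have E (i : 'I_n) : \sum_(j < n)
    (complex.Re (bell (mxtens_index (i, j)) 0) * complex.Re (bell (mxtens_index
      (i, j)) 0) +
     complex.Im (bell (mxtens_index (i, j)) 0) * complex.Im (bell (mxtens_index
       (i, j)) 0))
    = n%:R^-1.
  rewrite (bigD1 i)//= big1 => [|j ji].
    by rewrite !mxE mxtens_indexK eqxx /= mulr0 !addr0 -expr2 sqr_sqrtr
      ?invr_ge0.
  by rewrite !mxE mxtens_indexK eq_sym (negbTE ji) /= !mulr0 addr0.
under eq_bigr do rewrite E.
by rewrite sumr_const card_ord -[LHS]mulr_natl divff// pnatr_eq0 -lt0n.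
Qed.

Lemma bell_invariant (U : 'M[C]_n) : U \is unitarymx ->
  tensmx U (map_mx Num.conj U) *m bell = bell.
Proof.
move=> /unitarymxP/matrixP uU; apply/matrixP => x y; rewrite ord1 {y}.
case: (mxtens_indexP x) => i j; rewrite mxE sum_mxtens.
transitivity ((Num.sqrt n%:R^-1)%:C%C * \sum_p U i p * Num.conj (U j p)).
  rewrite mulr_sumr; apply: eq_bigr => p _.
  rewrite (bigD1 p)//= big1 => [|q qp].
    by rewrite tensmxE !mxE mxtens_indexK eqxx addr0 mulrC.
  by rewrite [bell _ _]mxE mxtens_indexK /= eq_sym (negbTE qp) mulr0.
have := uU i j; rewrite !mxE mxtens_indexK /= => uij.
have -> : \sum_p U i p * Num.conj (U j p) = (i == j)%:R.
  by rewrite -uij; apply: eq_bigr => p _; rewrite !mxE.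
by case: eqP; rewrite ?mulr1 ?mulr0.
Qed.

(** Of the [k ^ 2] terms of the output, the [k] diagonal ones are equal to the
    projection on [bell] by [bell_invariant], and the others are nonnegative. *)
Lemma channel_bell_ge (k : nat) (U : 'I_k -> 'M[C]_n) :
  (0 < k)%N -> (forall i, U i \is unitarymx) ->
  k%:R^-1 <= rip bell (random_unitary_channel (tens_family U (conj_family U))
                         (bell *m bell ^t*) *m bell).
Proof.
move=> k0 uU; have kR : 0 < k%:R :> R by rewrite ltr0n.
rewrite channel_proj -scalemxAl ripZr mulmx_suml rip_sumr.
have E t : rip bell ((tens_family U (conj_family U) t *m bell) *m
   (tens_family U (conj_family U) t *m bell) ^t* *m bell) =
   sqn (inner bell (tens_family U (conj_family U) t *m bell)).
  set w := tens_family _ _ _ *m bell; rewrite -mulmxA [w ^t* *m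
    bell]mx11_scalar mul_mx_scalar.
  rewrite -/(inner w bell) innerC /rip -scalemxAr mxE -/(inner _ _).
  by rewrite conj_mul_sqn.
under eq_bigr do rewrite E.
apply: le_trans (_ : (k * k)%:R^-1 * \sum_(i < k) 1 <= _).
  rewrite sumr_const card_ord natrM invfM -mulrA mulVf ?mulr1// gt_eqF//.
rewrite ler_wpM2l ?invr_ge0// sum_mxtens; apply: ler_sum => i _.
rewrite (bigD1 i)//= -[leLHS]addr0 lerD//; last by apply: sumr_ge0 => j _;
  exact: sqn_ge0.
rewrite /tens_family mxtens_indexK /= bell_invariant// inner_self rip_bell.
by rewrite /sqn /= expr1n expr0n addr0.
Qed.

Lemma min_output_entropy_bell (k : nat) (U : 'I_k -> 'M[C]_n) :
  (0 < k)%N -> (forall i, U i \is unitarymx) ->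
  min_output_entropy (tens_channel (random_unitary_channel U)
                                   (conj_random_unitary_channel U)) <=
    2 * ln k%:R - ln k%:R / k%:R + k%:R^-1.
Proof.
move=> k0 uU; have kk0 : (0 < k * k)%N by rewrite muln_gt0 k0.
rewrite conj_random_unitary_channelE tens_random_unitary_channelE.
have uW t : tens_family U (conj_family U) t \is unitarymx.
  by apply: tens_unitary => //; exact: conj_family_unitary.
have db : density (bell *m bell ^t*) by exact: density_proj rip_bell.
apply: le_trans (ge_inf _ _) _.
- by exists 0 => _ [X Xd <-]; apply: entropy_ge0; exact: density_channel.
- by exists (bell *m bell ^t*).
apply: entropy_le_rank rip_bell _ => //.
- exact: density_channel.
- by rewrite -mulnn; exact: rank_channel_proj.
- exact: channel_bell_ge.
Qed.

End Bell.

(** * Violation of additivity *)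

Lemma entropy_gap {R : realType} (S L k : R) : 0 < k -> 1 + 2 * S < L ->
  2 * L - L / k + k^-1 < (L - S / k) + (L - S / k).
Proof.
move=> k0 SL; rewrite -subr_gt0.
have -> : L - S / k + (L - S / k) - (2 * L - L / k + k^-1) =
          (L - (1 + 2 * S)) / k by field; rewrite gt_eqF.
by rewrite divr_gt0// subr_gt0.
Qed.

Lemma additivity_violated {R : realType} (k n : nat) (U : 'I_k -> 'M[R[i]]_n)
    (S : R) :
  (0 < k)%N -> (0 < n)%N -> 0 <= S -> 1 + 2 * S < ln k%:R ->
  (forall i, U i \is unitarymx) ->
  (forall x, rip x x <= 1 -> hs (gram_offdiag (fun i => U i *m x)) <= S) ->
  min_output_entropy (tens_channel (random_unitary_channel U)
                                   (conj_random_unitary_channel U)) <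
  min_output_entropy (random_unitary_channel U) +
  min_output_entropy (conj_random_unitary_channel U).
Proof.
move=> k0 n0 S0 Sk uU US; have kR : 0 < k%:R :> R by rewrite ltr0n.
apply: le_lt_trans (min_output_entropy_bell n0 k0 uU) _.
apply: lt_le_trans (entropy_gap kR Sk) (lerD _ _).
  exact: min_output_entropy_ge.
rewrite conj_random_unitary_channelE.
apply: (min_output_entropy_ge k0 n0 S0 (conj_family_unitary uU)).
by move=> x x1; rewrite hs_gram_offdiag_conj; apply: US; rewrite rip_conj.
Qed.

Theorem theorem3p4 (R : realType) :
  exists k0 : nat, forall k : nat, (k0 <= k)%N ->
  forall (d : measure_display) (T : measurableType d) (P : probability T R)
    (U : forall n : nat, 'I_k -> T -> 'M[R[i]]_n),
    (forall n : nat, (1 <= n)%N ->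
       (forall i : 'I_k, haar_unitary P (U n i)) /\
       mutually_independent P (U n)) ->
    {ae P, forall w : T, exists n0 : nat, forall n : nat, (n0 <= n)%N ->
       let Psi := random_unitary_channel (fun i : 'I_k => U n i w) in
       let Psibar := conj_random_unitary_channel (fun i : 'I_k => U n i w) in
       min_output_entropy (tens_channel Psi Psibar)
         < min_output_entropy Psi + min_output_entropy Psibar}.
Proof.
pose S : R := (205 * (1 + 37 * ln 2)) ^+ 2.
have S0 : 0 <= S by exact: sqr_ge0.
(* This threshold makes [ln k] exceed [1 + 2 S]. *)
exists (Num.truncn (expR (1 + 2 * S))).+1 => k kS d T P U hU.
have k0 : (0 < k)%N by exact: leq_trans kS.
have Sk : 1 + 2 * S < ln k%:R.
  rewrite -ltr_expR lnK ?posrE ?ltr0n//.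
  by apply: lt_le_trans (truncnS_gt _) _; rewrite ler_nat.
apply: filterS (haar_gram_bound hU) => w [n0 Uw].
exists n0.+1; move=> n n0n /=.
have n_gt0 : (0 < n)%N by apply: leq_trans n0n.
have uU i : U n i w \is unitarymx by exact: haar_unitarymx ((hU n n_gt0).1 i) w.
exact: additivity_violated k0 n_gt0 S0 Sk uU (Uw n (ltnW n0n)).
Qed.
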